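(* Let $\zeta_5$ be a primitive fifth root of unity. Then \[ \frac{(-q;q)_\infty}{(q;q)_\infty}\Bigl(\frac12+\sum_{n=1}^\infty\frac{(1-\zeta_5)(1-\zeta_5^{-1})(-1)^nq^n}{(1-\zeta_5q^n)(1-\zeta_5^{-1}q^n)}\Bigr)=\sum_{r=0}^4q^rB_r(q^5), \] where \begin{align*} B_0(q)&=\frac{(q^5;q^5)_\infty^2(q^4,q^6;q^{10})_\infty}{2(q^{10};q^{10})_\infty(q^2,q^3;q^5)_\infty^2}+(\zeta_5+\zeta_5^{-1})\frac{q(q^{10};q^{10})_\infty}{(q^3,q^4,q^6,q^7;q^{10})_\infty},\\ B_1(q)&=(\zeta_5+\zeta_5^{-1}-1)\frac{(q^4,q^6,q^{10};q^{10})_\infty}{(q^2,q^8;q^{10})_\infty^2(q^3,q^7;q^{10})_\infty},\\ B_2(q)&=(1-2\zeta_5-2\zeta_5^{-1})\frac{(q^{10};q^{10})_\infty}{(q,q^9;q^{10})_\infty(q^4,q^6;q^{10})_\infty},\\ B_3(q)&=-\frac{(q^{10};q^{10})_\infty}{(q^2,q^3;q^5)_\infty},\\ B_4(q)&=(\zeta_5+\zeta_5^{-1})\frac{(q^2,q^8,q^{10};q^{10})_\infty}{(q,q^9;q^{10})_\infty(q^4,q^6;q^{10})_\infty^2}. \end{align*}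
   Context: $(a;q)_\infty=\prod_{k\ge0}(1-aq^k)$ and $(a_1,\dots,a_j;q)_\infty=(a_1;q)_\infty\cdots(a_j;q)_\infty$; identities are of formal power series in $q$. *)

(* Defs.v *)
From HB Require Import structures.
From mathcomp Require Import all_boot all_order all_algebra all_field.
Set Implicit Arguments. Unset Strict Implicit. Unset Printing Implicit Defensive.
Import Order.TTheory GRing.Theory Num.Theory.
Local Open Scope ring_scope.

Definition fps := nat -> algC.

Definition fconst (c : algC) : fps := fun n => if n == 0%N then c else 0.
Definition fqpow (m : nat) : fps := fun n => if n == m then 1 else 0.
Definition fadd (f g : fps) : fps := fun n => f n + g n.
Definition fscale (c : algC) (f : fps) : fps := fun n => c * f n.
Definition fmul (f g : fps) : fps :=
  fun n => \sum_(i < n.+1) f i * g (n - i)%N.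

Fixpoint finv_seq (f : fps) (n : nat) : seq algC :=
  match n with
  | 0 => [:: (f 0%N)^-1]
  | m.+1 => let s := finv_seq f m in
            rcons s (- (f 0%N)^-1 * \sum_(i < m.+1) f (m.+1 - i)%N * s`_i)
  end.
Definition finv (f : fps) : fps := fun n => (finv_seq f n)`_n.
Definition fdiv (f g : fps) : fps := fmul f (finv g).

Definition fdil (d : nat) (f : fps) : fps :=
  fun n => if (d %| n)%N then f (n %/ d)%N else 0.

Definition fonem (c : algC) (m : nat) : fps :=
  fun n => (if n == 0%N then 1 else 0) - (if n == m then c else 0).

(* (c q^a ; q^b)_oo = prod_(k>=0) (1 - c q^(a+b k)), for a >= 1, b >= 1.
   Since a + b k >= k + 1, only the factors with k <= n affect the
   coefficient of q^n, so that coefficient is read off the finite product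
   over k < n+1 (a polynomial). *)
Definition qpoch (c : algC) (a b : nat) : fps :=
  fun n => (\prod_(k < n.+1) (1 - c *: 'X^(a + b * k)) : {poly algC})`_n.
Definition qp (a b : nat) : fps := qpoch 1 a b.

(* sum_(k >= 1) T k, valid when T k = O(q^k): the coefficient of q^n only
   receives contributions from k <= n. *)
Definition fsum1 (T : nat -> fps) : fps :=
  fun n => \sum_(1 <= k < n.+1) T k n.

Definition fsq (f : fps) : fps := fmul f f.

Section Bs.
Variable z : algC.
Let w := z + z^-1.

Definition B0 : fps :=
  fadd
    (fdiv (fmul (fsq (qp 5 5)) (fmul (qp 4 10) (qp 6 10)))
          (fmul (fconst 2)
             (fmul (qp 10 10) (fsq (fmul (qp 2 5) (qp 3 5))))))
    (fscale w (fdiv (fmul (fqpow 1) (qp 10 10))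
                    (fmul (fmul (qp 3 10) (qp 4 10)) (fmul (qp 6 10) (qp 7 10))))).

Definition B1 : fps :=
  fscale (w - 1)
    (fdiv (fmul (fmul (qp 4 10) (qp 6 10)) (qp 10 10))
          (fmul (fsq (fmul (qp 2 10) (qp 8 10))) (fmul (qp 3 10) (qp 7 10)))).

Definition B2 : fps :=
  fscale (1 - 2 * z - 2 * z^-1)
    (fdiv (qp 10 10)
          (fmul (fmul (qp 1 10) (qp 9 10)) (fmul (qp 4 10) (qp 6 10)))).

Definition B3 : fps :=
  fscale (-1) (fdiv (qp 10 10) (fmul (qp 2 5) (qp 3 5))).

Definition B4 : fps :=
  fscale w
    (fdiv (fmul (fmul (qp 2 10) (qp 8 10)) (qp 10 10))
          (fmul (fmul (qp 1 10) (qp 9 10)) (fsq (fmul (qp 4 10) (qp 6 10))))).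

Definition Bser (r : nat) : fps :=
  match r with 0 => B0 | 1 => B1 | 2 => B2 | 3 => B3 | _ => B4 end.
End Bs.

Definition lhs_2p14 (z : algC) : fps :=
  fmul (fdiv (qpoch (-1) 1 1) (qp 1 1))
    (fadd (fconst (2^-1))
       (fsum1 (fun n => fscale ((1 - z) * (1 - z^-1) * (-1) ^+ n)
                         (fdiv (fqpow n) (fmul (fonem z n) (fonem (z^-1) n)))))).

Definition rhs_2p14 (z : algC) : fps :=
  fun n => \sum_(r < 5) fmul (fqpow r) (fdil 5 (Bser z r)) n.

(* Main.v *)
(** A partial-fraction expansion of
    prod_(k <= N) (1 + z q^k)(1 + q^k/z) / ((1 - z q^k)(1 - q^k/z)), in the limit
    N -> oo, turns the Lambert series into a product; at z = zeta_5, writing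
    T(y) = (y q, q/y, q; q)_oo, the left-hand side X satisfies
      2 (q^2;q^2)_oo (q^5;q^5)_oo^2 X = T(z) T(z^2)^2 T(-z).
    Since (1 - y) T(y) is a theta series by the Jacobi triple product, splitting its
    index modulo 5 dissects every T(y).  The identity
    (q;q)_oo (q^5;q^5)_oo = T(z) T(z^2) then dissects (q^2;q^2)_oo too, after q -> q^2,
    so the pentagonal number theorem and the quintuple product are not needed.
    Comparing residues modulo 5 leaves five identities between the thetas
    J_a = (q^a, q^(10-a), q^10; q^10)_oo, all of which are combinations of the two
    Weierstrass relations
      J_2^2 J_3 J_5 = J_1 J_3 J_4^2 + q J_1^2 J_2 J_4,
      J_1 J_4^2 J_5 = J_2 J_3^2 J_4 - q J_1 J_2^2 J_3.
    The latter are Pluecker relations, as J_(a+b) J_(a-b) =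
    F_a G_b - q^(a-b) G_a F_b is q^a times a 2 x 2 determinant. *)
From HB Require Import structures.
From mathcomp Require Import all_boot all_order all_algebra all_field.
From mathcomp Require Import boolp.
From mathcomp Require Import ring zify.
Require Import Defs.
Set Implicit Arguments. Unset Strict Implicit. Unset Printing Implicit Defensive.
Import Order.TTheory GRing.Theory Num.Theory.
Local Open Scope ring_scope.

(** A certificate of ideal membership: the cofactors [a] and [b] are supplied and [ring] checks the
    last premise. When one relation suffices it is passed twice, with [b := 0]. *)
Lemma lincomb2 (R : pzRingType) (a b x y x' y' l r : R) :
  x = y -> x' = y' -> l - r = a * (x - y) + b * (x' - y') -> l = r.
Proof.
by move=> -> -> /eqP; rewrite !subrr !mulr0 addr0 subr_eq0 => /eqP.
Qed.

(** * The ring of formal power series *)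

HB.instance Definition _ := gen_eqMixin fps.
HB.instance Definition _ := gen_choiceMixin fps.

Lemma fpsP (f g : fps) : (forall n, f n = g n) -> f = g.
Proof. by move=> fg; apply: funext. Qed.

Fact fps_addA : associative fadd.
Proof. by move=> f g h; apply: fpsP => n; rewrite /fadd addrA. Qed.
Fact fps_addC : commutative fadd.
Proof. by move=> f g; apply: fpsP => n; rewrite /fadd addrC. Qed.
Fact fps_add0 : left_id (fun _ => 0 : algC) fadd.
Proof. by move=> f; apply: fpsP => n; rewrite /fadd add0r. Qed.
Fact fps_addN : left_inverse (fun _ => 0 : algC) (fun (f : fps) n => - f n) fadd.
Proof. by move=> f; apply: fpsP => n; rewrite /fadd addNr. Qed.
HB.instance Definition _ :=
  GRing.isZmodule.Build fps fps_addA fps_addC fps_add0 fps_addN.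

Lemma trunc_coefE (f : fps) n k : (k <= n)%N -> (\poly_(i < n.+1) f i)`_k = f k.
Proof. by move=> kn; rewrite coef_poly ltnS kn. Qed.

(** Coefficients up to [n] see only the truncations, so associativity and commutativity are
    inherited from polynomials. *)
Lemma fmul_trunc (f g : fps) n k : (k <= n)%N ->
  fmul f g k = ((\poly_(i < n.+1) f i) * (\poly_(i < n.+1) g i))`_k.
Proof.
move=> kn; rewrite coefM /fmul; apply: eq_bigr => i _.
have ik : (i <= k)%N by rewrite -ltnS.
by rewrite !trunc_coefE // ?(leq_trans ik) // (leq_trans (leq_subr _ _)).
Qed.

Fact fps_mulA : associative fmul.
Proof.
move=> f g h; apply: fpsP => n.
transitivity ((\poly_(i < n.+1) f i * (\poly_(i < n.+1) g i * \poly_(i < n.+1) h i))`_n).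
  rewrite [RHS]coefM /fmul; apply: eq_bigr => i _.
  have ik : (i <= n)%N by rewrite -ltnS.
  by rewrite trunc_coefE // -fmul_trunc ?leq_subr.
rewrite mulrA [LHS]coefM /fmul; apply: eq_bigr => i _.
have ik : (i <= n)%N by rewrite -ltnS.
by rewrite trunc_coefE ?leq_subr // -fmul_trunc.
Qed.
Fact fps_mulC : commutative fmul.
Proof.
by move=> f g; apply: fpsP => n; rewrite (fmul_trunc _ _ (leqnn n)) mulrC -fmul_trunc.
Qed.
Fact fps_mul1 : left_id (fconst 1) fmul.
Proof.
move=> f; apply: fpsP => n; rewrite /fmul big_ord_recl /fconst /= mul1r subn0.
by rewrite big1 ?addr0 // => i _; rewrite mul0r.
Qed.
Fact fps_mulD : left_distributive fmul fadd.
Proof.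
move=> f g h; apply: fpsP => n; rewrite /fmul /fadd -big_split /=.
by apply: eq_bigr => i _; rewrite mulrDl.
Qed.
Fact fps_neq0 : fconst 1 != (0 : fps).
Proof.
by apply/eqP => /(congr1 (@^~ 0%N)) /eqP; rewrite /fconst /= oner_eq0.
Qed.
HB.instance Definition _ :=
  GRing.Zmodule_isComNzRing.Build fps fps_mulA fps_mulC fps_mul1 fps_mulD fps_neq0.

Lemma fps_mulE (f g : fps) n : (f * g) n = \sum_(i < n.+1) f i * g (n - i)%N.
Proof. by []. Qed.

Lemma fps_sumE (I : Type) (r : seq I) (P : pred I) (F : I -> fps) n :
  (\sum_(i <- r | P i) F i) n = \sum_(i <- r | P i) F i n.
Proof. by elim/big_rec2: _ => // i x f _ <-. Qed.

Definition fps_of_poly (p : {poly algC}) : fps := fun n => p`_n.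

Fact fps_of_poly_zmod : zmod_morphism fps_of_poly.
Proof. by move=> p r; apply: fpsP => n; rewrite /fps_of_poly coefB. Qed.
Fact fps_of_poly_monoid : monoid_morphism fps_of_poly.
Proof.
split; first by apply: fpsP => n; rewrite /fps_of_poly coef1 /= /GRing.one /= /fconst; case: eqP.
by move=> p r; apply: fpsP => n; rewrite /fps_of_poly coefM.
Qed.
HB.instance Definition _ :=
  GRing.isZmodMorphism.Build {poly algC} fps fps_of_poly fps_of_poly_zmod.
HB.instance Definition _ :=
  GRing.isMonoidMorphism.Build {poly algC} fps fps_of_poly fps_of_poly_monoid.

Lemma fconstE c : fconst c = fps_of_poly c%:P.
Proof. by apply: fpsP => n; rewrite /fps_of_poly coefC. Qed.

Fact fconst_zmod : zmod_morphism fconst.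
Proof. by move=> c d; rewrite !fconstE !rmorphB. Qed.
Fact fconst_monoid : monoid_morphism fconst.
Proof. by split=> [|c d]; rewrite !fconstE ?rmorph1 ?rmorphM. Qed.
HB.instance Definition _ := GRing.isZmodMorphism.Build algC fps fconst fconst_zmod.
HB.instance Definition _ := GRing.isMonoidMorphism.Build algC fps fconst fconst_monoid.

Local Notation q := (fqpow 1).

Lemma fqpowE m : fqpow m = q ^+ m.
Proof.
have E k : fqpow k = fps_of_poly 'X^k.
  by apply: fpsP => n; rewrite /fps_of_poly coefXn /fqpow; case: eqP.
by rewrite !E -rmorphXn -exprM mul1n.
Qed.

Lemma fscaleE c f : fscale c f = fconst c * f.
Proof.
apply: fpsP => n; rewrite fps_mulE big_ord_recl /fconst /= subn0 big1 ?addr0 //.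
by move=> i _; rewrite mul0r.
Qed.

Lemma fonemE c m : fonem c m = 1 - fconst c * q ^+ m.
Proof.
rewrite -fscaleE -fqpowE; apply: fpsP => n; rewrite /fonem.
rewrite -[RHS]/((if n == 0%N then 1 else 0) - c * (if n == m then 1 else 0)).
by case: (n == m); rewrite ?mulr1 ?mulr0.
Qed.

Lemma size_finv_seq f n : size (finv_seq f n) = n.+1.
Proof. by elim: n => //= n IH; rewrite size_rcons IH. Qed.

Lemma nth_finv_seq f n k : (k <= n)%N -> (finv_seq f n)`_k = finv f k.
Proof.
elim: n => [|n IH]; first by case: k.
rewrite leq_eqVlt => /orP [/eqP -> //|kn].
by rewrite /= nth_rcons size_finv_seq kn IH.
Qed.

Lemma finvP (f : fps) : f 0%N != 0 -> f * finv f = 1.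
Proof.
move=> f0; apply: fpsP => -[|n]; rewrite fps_mulE.
  by rewrite big_ord1 /finv /= mulfV.
rewrite big_ord_recl subn0 /= {1}/finv /= nth_rcons size_finv_seq ltnn eqxx.
rewrite [X in _ * (_ * X)](_ : _ = \sum_(i < n.+1) f (lift ord0 i) * finv f (n.+1 - lift ord0 i)%N).
  by rewrite mulrA mulrN mulfV // mulN1r addNr.
(* The recursion of [finv_seq] is indexed by the inverse, the convolution by [f]; reversing the sum
   matches them. *)
rewrite (reindex_inj rev_ord_inj) /=; apply: eq_bigr => i _.
rewrite /bump /= add1n subSS nth_finv_seq ?leq_subr //; congr (f _ * _).
by have := ltn_ord i; lia.
Qed.

Lemma fdivP (f g : fps) : g 0%N != 0 -> g * fdiv f g = f.
Proof.
move=> g0; have -> : fdiv f g = f * finv g by [].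
by rewrite mulrCA finvP // mulr1.
Qed.

Lemma fps_mulIf (f g h : fps) : f 0%N != 0 -> f * g = f * h -> g = h.
Proof.
move=> f0 /(congr1 ( *%R (finv f))); rewrite !mulrA (mulrC (finv f)).
by rewrite finvP // !mul1r.
Qed.

Lemma fps_mul0E (f g : fps) : (f * g) 0%N = f 0%N * g 0%N.
Proof. by rewrite fps_mulE big_ord1. Qed.

(** * Congruence modulo [q ^+ N] *)

Definition feq (N : nat) (f g : fps) := forall k, (k < N)%N -> f k = g k.

Lemma feq_refl N f : feq N f f. Proof. by []. Qed.
Lemma eq_feq N f g : f = g -> feq N f g.
Proof. by move=> ->. Qed.
Lemma feq_sym N f g : feq N f g -> feq N g f.
Proof. by move=> fg k kN; rewrite fg. Qed.
Lemma feq_trans N g f h : feq N f g -> feq N g h -> feq N f h.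
Proof. by move=> fg gh k kN; rewrite fg // gh. Qed.
Lemma feq_eq f g : (forall N, feq N f g) -> f = g.
Proof. by move=> fg; apply: fpsP => n; apply: (fg n.+1). Qed.
Lemma feqD N f f' g g' : feq N f f' -> feq N g g' -> feq N (f + g) (f' + g').
Proof. by move=> ff gg k kN; rewrite -[LHS]/(f k + g k) ff // gg. Qed.
Lemma feqM N f f' g g' : feq N f f' -> feq N g g' -> feq N (f * g) (f' * g').
Proof.
move=> ff gg k kN; rewrite !fps_mulE; apply: eq_bigr => i _.
have ik : (i <= k)%N by rewrite -ltnS.
by rewrite ff ?gg // ?(leq_ltn_trans ik) // (leq_ltn_trans (leq_subr _ _)).
Qed.
Lemma feq_sum N (I : Type) (r : seq I) (P : pred I) (F G : I -> fps) :
  (forall i, P i -> feq N (F i) (G i)) ->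
  feq N (\sum_(i <- r | P i) F i) (\sum_(i <- r | P i) G i).
Proof.
move=> FG; elim/big_rec2: _ => // i f g Pi fg; exact: feqD (FG i Pi) fg.
Qed.
Lemma feq_prod N (I : Type) (r : seq I) (P : pred I) (F G : I -> fps) :
  (forall i, P i -> feq N (F i) (G i)) ->
  feq N (\prod_(i <- r | P i) F i) (\prod_(i <- r | P i) G i).
Proof.
move=> FG; elim/big_rec2: _ => // i f g Pi fg; exact: feqM (FG i Pi) fg.
Qed.

Lemma feq_qX N m f : (N <= m)%N -> feq N (q ^+ m * f) 0.
Proof.
move=> Nm k kN; rewrite -fqpowE fps_mulE big1 // => i _.
rewrite /fqpow ifN ?mul0r //; apply/eqP => im.
by have := ltn_ord i; rewrite im ltnS leqNgt (leq_trans kN Nm).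
Qed.

Lemma feq_mulIf N (f g h : fps) : f 0%N != 0 -> feq N (f * g) (f * h) -> feq N g h.
Proof.
move=> f0 /(feqM (@feq_refl N (finv f))); rewrite !mulrA (mulrC (finv f)).
by rewrite finvP // !mul1r.
Qed.

(** * Finite and infinite q-shifted factorials *)

Definition pochn (c : algC) (a m n : nat) : fps :=
  \prod_(k < n) (1 - fconst c * q ^+ (a + m * k)).

Lemma pochnS c a m n :
  pochn c a m n.+1 = pochn c a m n * (1 - fconst c * q ^+ (a + m * n)).
Proof. by rewrite /pochn big_ord_recr. Qed.

Lemma pochnE c a m n :
  pochn c a m n = fps_of_poly (\prod_(k < n) (1 - c *: 'X^(a + m * k))).
Proof.
rewrite rmorph_prod; apply: eq_bigr => k _; rewrite rmorphB rmorph1 /=.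
rewrite -mul_polyC rmorphM /= -fconstE; congr (1 - _ * _).
by rewrite -fqpowE; apply: fpsP => j; rewrite /fps_of_poly coefXn /fqpow; case: eqP.
Qed.

Lemma pochn_stable c a m N n :
  (0 < m)%N -> (N <= a + m * n)%N -> feq N (pochn c a m n.+1) (pochn c a m n).
Proof.
move=> m0 Nn; rewrite pochnS mulrBr mulr1 -[X in feq _ _ X]addr0.
apply: feqD => //; rewrite mulrCA mulrA mulrC -mulrN; exact: feq_qX.
Qed.

Lemma pochn_feq c a m N n n' : (0 < m)%N -> (N <= a + m * n)%N -> (n <= n')%N ->
  feq N (pochn c a m n') (pochn c a m n).
Proof.
move=> m0 Nn; elim: n' => [|n' IH]; first by rewrite leqn0 => /eqP ->.
rewrite leq_eqVlt => /orP [/eqP -> //|]; rewrite ltnS => nn'.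
apply: feq_trans (IH nn'); apply: pochn_stable => //.
by apply: leq_trans Nn _; rewrite leq_add2l leq_mul2l nn' orbT.
Qed.

(** The definition reads the coefficient of q^k off k + 1 factors, which may be more or fewer than
    [n]; either way the factors in excess are 1 up to that coefficient. *)
Lemma qpoch_feq c a m N n : (0 < m)%N -> (N <= a + m * n)%N ->
  feq N (qpoch c a m) (pochn c a m n).
Proof.
move=> m0 Nn k kN; rewrite /qpoch -[LHS]/(fps_of_poly _ k) -pochnE.
case: (leqP n k.+1) => nk; first by rewrite (pochn_feq _ m0 Nn nk).
by rewrite (@pochn_feq _ _ _ k.+1 k.+1 n) //; nia.
Qed.

Lemma qpoch_feqW c a m n : (0 < m)%N -> feq n (qpoch c a m) (pochn c a m n).
Proof. by move=> m0; apply: qpoch_feq => //; nia. Qed.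

Lemma qpoch_eq0 c a m : (0 < a)%N -> (0 < m)%N -> qpoch c a m 0%N = 1.
Proof. by move=> a0 m0; rewrite (@qpoch_feq _ _ _ 1 0) ?addn_gt0 ?a0 // /pochn big_ord0. Qed.

Lemma pochn_at0 c a m n : (0 < a)%N -> (0 < m)%N -> pochn c a m n 0%N = 1.
Proof. by move=> a0 m0; rewrite -(@qpoch_feq c a m 1 n) ?qpoch_eq0 // addn_gt0 a0. Qed.

Lemma qX_at0 n : (0 < n)%N -> (q ^+ n) 0%N = 0.
Proof. by move=> n0; rewrite -fqpowE /fqpow; case: eqP n0 => // <-. Qed.

Lemma one_sub_qX_at0 c n : (0 < n)%N -> (1 - c * q ^+ n) 0%N != 0.
Proof.
move=> n0; have -> : (1 - c * q ^+ n) 0%N = 1 - (c * q ^+ n) 0%N by [].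
by rewrite fps_mul0E qX_at0 // mulr0 subr0 oner_eq0.
Qed.

Lemma one_subr_qX_at0 n : (0 < n)%N -> (1 - q ^+ n) 0%N != 0.
Proof. by move=> n0; rewrite -[q ^+ n]mul1r one_sub_qX_at0. Qed.

(** * The Lambert series as an infinite product *)

Definition poch_ratio (n : nat) : fps := pochn (-1) 1 1 n * finv (pochn 1 1 1 n).

Lemma poch_ratioP n : pochn 1 1 1 n * poch_ratio n = pochn (-1) 1 1 n.
Proof. by rewrite /poch_ratio mulrCA finvP ?mulr1 // pochn_at0 // oner_eq0. Qed.

Lemma poch_ratio0 : poch_ratio 0 = 1.
Proof. by rewrite -[poch_ratio 0]mul1r -[1 in LHS](_ : pochn 1 1 1 0 = 1) ?poch_ratioP /pochn big_ord0. Qed.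

Lemma poch_ratioS n : poch_ratio n.+1 * (1 - q ^+ n.+1) = poch_ratio n * (1 + q ^+ n.+1).
Proof.
apply: (@fps_mulIf (pochn 1 1 1 n)); first by rewrite pochn_at0 // oner_eq0.
have := poch_ratioP n.+1; rewrite !pochnS -poch_ratioP rmorphN1 rmorph1 !mul1n !add1n.
by move=> H; transitivity (pochn 1 1 1 n * poch_ratio n * (1 - -1 * q ^+ n.+1)); [rewrite -H|]; ring.
Qed.

(* With A(t) = sum_n (-q;q)_n/(q;q)_n t^n, which satisfies
   (1 - t) A(t) = (1 + q t) A(q t), [ratio_conv w n] is the coefficient of t^n in
   A(-t) A(w t).  For w = 1 the product is 1/(1 - t^2). *)
Definition ratio_conv (w : fps) (n : nat) : fps :=
  \sum_(k < n.+1) (-1) ^+ k * poch_ratio k * (w ^+ (n - k) * poch_ratio (n - k)).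

(** Coefficient of t^(n+1) in (1 - t) A(t) A(-t) = (1 + q t) A(q t) A(-t). *)
Lemma ratio_conv_eq1 n : ratio_conv 1 n.+1 - ratio_conv q n.+1 = ratio_conv 1 n + q * ratio_conv q n.
Proof.
rewrite /ratio_conv -sumrB big_ord_recr /= subnn !expr0 subrr addr0.
rewrite mulr_sumr -big_split /=; apply: eq_bigr => k _.
rewrite subSn ?leq_ord // !expr1n; set m := (n - k)%N.
transitivity ((-1) ^+ k * poch_ratio k * (poch_ratio m.+1 * (1 - q ^+ m.+1))); first by ring.
by rewrite poch_ratioS exprS; ring.
Qed.

(** The functional equation at -t: coefficient of t^(n+1) in (1 + t) A(-t) A(q t) = (1 - q t) A(-q
    t) A(q t). *)
Lemma ratio_conv_eq2 n :
  q ^+ n.+1 * ratio_conv 1 n.+1 - ratio_conv q n.+1 = q ^+ n.+1 * ratio_conv 1 n + ratio_conv q n.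
Proof.
rewrite /ratio_conv mulr_sumr -sumrB big_ord_recl /= !subn0 expr1n.
rewrite [X in X + _](_ : _ = 0) ?add0r; last by ring.
rewrite mulr_sumr -big_split /=; apply: eq_bigr => k _; rewrite /bump /= add1n subSS !expr1n.
have kn : (k <= n)%N by rewrite leq_ord.
set m := (n - k)%N; have -> : q ^+ n.+1 = q ^+ m * q ^+ k.+1 by rewrite -exprD; congr (_ ^+ _); rewrite /m; lia.
transitivity ((-1) ^+ k * (poch_ratio k.+1 * (1 - q ^+ k.+1)) * q ^+ m * poch_ratio m); first by rewrite (exprS (-1)); ring.
by rewrite poch_ratioS; ring.
Qed.

(** The two recurrences are linear in the values at [n.+1], with determinant [q ^+ n.+1 - 1]. This
    is invertible, so they determine both values by induction. *)
Lemma ratio_conv_value n :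
  ratio_conv 1 n = (~~ odd n)%:R /\ (1 - q) * ratio_conv q n = (-1) ^+ n * (1 - q ^+ n.+1).
Proof.
elim: n => [|n [IH1 IH2]].
  by rewrite /ratio_conv !big_ord1 /= !subnn poch_ratio0 !expr0; split; ring.
have E1 := ratio_conv_eq1 n; have E2 := ratio_conv_eq2 n.
have cE : (1 - q) * ratio_conv q n.+1 = (-1) ^+ n.+1 * (1 - q ^+ n.+2).
  apply: (@fps_mulIf (1 - q ^+ n.+1)); first exact: one_subr_qX_at0.
  have H : (1 - q ^+ n.+1) * ratio_conv q n.+1 = - (1 - q ^+ n.+2) * ratio_conv q n.
    by apply: (lincomb2 (a := q ^+ n.+1) (b := -1) E1 E2); rewrite (exprS q n.+1); ring.
  by rewrite mulrCA H mulrCA IH2 (exprS (-1)); ring.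
split=> //; apply: (@fps_mulIf (1 - q)); first exact: (@one_subr_qX_at0 1).
have sgn : (-1) ^+ n.+1 = (~~ odd n.+1)%:R - (~~ odd n)%:R :> fps.
  by rewrite -signr_odd /=; case: (odd n); rewrite /= ?expr0 ?expr1; ring.
have : (1 - q) * (ratio_conv 1 n.+1 - ratio_conv 1 n) = (1 - q) * (-1) ^+ n.+1.
  rewrite (_ : ratio_conv 1 n.+1 - ratio_conv 1 n = ratio_conv q n.+1 + q * ratio_conv q n); last by apply: (lincomb2 (a := 1) (b := 0) E1 E1); ring.
  by rewrite mulrDr cE mulrCA IH2 (exprS (-1)) (exprS q n.+1); ring.
rewrite sgn IH1 => H.
by transitivity ((1 - q) * (ratio_conv 1 n.+1 - (~~ odd n)%:R) + (1 - q) * (~~ odd n)%:R); [ring|rewrite H; ring].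
Qed.

Lemma sum_symmetric (V : zmodType) (F : nat -> V) N :
  (forall n, (n <= N)%N -> F (N - n)%N = F (N + n)%N) ->
  \sum_(k < (N + N).+1) F k = F N + (\sum_(n < N) F (N + n.+1)%N) *+ 2.
Proof.
move=> FN; rewrite -(big_mkord xpredT) -addnS big_mkord big_split_ord /= big_ord_recl /= addn0.
rewrite addrCA; congr (_ + _); rewrite mulr2n; congr (_ + _).
rewrite (reindex_inj rev_ord_inj) /=; apply: eq_bigr => i _.
by rewrite FN.
Qed.

(** The coefficient of t^(2N) in A(-t) A(t) = 1/(1 - t^2), folded about its central index and
    multiplied by (-1)^N. *)
Lemma alternating_sum N :
  poch_ratio N ^+ 2 + 2 * (\sum_(n < N) (-1) ^+ n.+1 * (poch_ratio (N + n.+1) * poch_ratio (N - n.+1)))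
  = (-1) ^+ N.
Proof.
have H : ratio_conv 1 (N + N) = 1.
  by have [-> _] := ratio_conv_value (N + N); rewrite addnn odd_double.
rewrite /ratio_conv (sum_symmetric (F := fun k => (-1) ^+ k * poch_ratio k * (1 ^+ (N + N - k) * poch_ratio (N + N - k)))) in H; last first.
  move=> n nN; have -> : (N + N - (N - n) = N + n)%N by lia.
  have -> : (N + N - (N + n) = N - n)%N by lia.
  have -> : (-1) ^+ (N + n) = (-1) ^+ (N - n) :> fps.
    by rewrite -signr_odd -[RHS]signr_odd oddD oddB.
  by rewrite !expr1n; ring.
rewrite -[RHS]mulr1 -[X in _ = _ * X]H mulrDr -[(\sum_(i < N) _) *+ 2]mulr_natl; congr (_ + _).
  rewrite expr1n addnK; transitivity ((-1) ^+ N * (-1) ^+ N * poch_ratio N ^+ 2); last by ring.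
  by rewrite -expr2 sqrr_sign mul1r.
rewrite mulrCA; congr (_ * _); rewrite mulr_sumr; apply: eq_bigr => i _.
have -> : (N + N - (N + i.+1) = N - i.+1)%N by have := ltn_ord i; lia.
rewrite exprD expr1n.
transitivity ((-1) ^+ N * (-1) ^+ N * (-1) ^+ i.+1 * (poch_ratio (N + i.+1) * poch_ratio (N - i.+1))); last by ring.
by rewrite -expr2 sqrr_sign mul1r.
Qed.

Section Lambert.
Variables x y : fps.
Hypothesis xy1 : x * y = 1.

(* [lsum N] is the partial-fraction expansion of
   prod_(n <= N) lnum n / lden n, normalised by its value at x = 1. *)
Definition lden n : fps := (1 - x * q ^+ n) * (1 - y * q ^+ n).
Definition lnum n : fps := (1 + x * q ^+ n) * (1 + y * q ^+ n).
Definition lterm N n : fps := (-1) ^+ n * (poch_ratio (N + n) * poch_ratio (N - n)).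
Definition lsum N : fps :=
  poch_ratio N ^+ 2 + 2 * ((1 - x) * (1 - y)) *
    (\sum_(n < N) q ^+ n.+1 * lterm N n.+1 * finv (lden n.+1)).

Lemma lden_at0 n : (0 < n)%N -> lden n 0%N != 0.
Proof. by move=> n0; rewrite /lden fps_mul0E mulf_neq0 ?one_sub_qX_at0. Qed.

(** Since x y = 1, both [lden N] and [lden n] are linear in x + y; this is the division of
    [q ^+ n * lden N] by [lden n], with quotient [q ^+ N]. *)
Lemma lden_split N n : (0 < n <= N)%N -> 
  lden N * (q ^+ n * finv (lden n)) =
  q ^+ N + q ^+ n * (1 - q ^+ (N - n)) * (1 - q ^+ (N + n)) * finv (lden n).
Proof.
case/andP=> n0 nN; have Dn := finvP (lden_at0 n0).
move: Dn; set I := finv _; rewrite /lden exprD.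
have -> : q ^+ N = q ^+ n * q ^+ (N - n) by rewrite -exprD subnKC.
move: (q ^+ n) (q ^+ (N - n)) => a b Dn.
by apply: (lincomb2 (a := a ^+ 3 * b ^+ 2 * I - a ^+ 3 * b * I) (b := a * b) xy1 Dn); ring.
Qed.

Lemma lnum_split N n : (0 < n <= N)%N -> 
  lnum N * (q ^+ n * finv (lden n)) =
  - q ^+ N + q ^+ n * (1 + q ^+ (N - n)) * (1 + q ^+ (N + n)) * finv (lden n).
Proof.
case/andP=> n0 nN; have Dn := finvP (lden_at0 n0).
move: Dn; set I := finv _; rewrite /lden /lnum exprD.
have -> : q ^+ N = q ^+ n * q ^+ (N - n) by rewrite -exprD subnKC.
move: (q ^+ n) (q ^+ (N - n)) => a b Dn.
apply: (lincomb2 (a := a ^+ 3 * b ^+ 2 * I + a ^+ 3 * b * I) (b := - (a * b)) xy1 Dn); ring.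
Qed.

(** Turns the remainders left by [lden_split] at [N.+1] into those left by [lnum_split]. *)
Lemma lterm_rec N n : (n <= N)%N ->
  lterm N.+1 n * ((1 - q ^+ (N.+1 - n)) * (1 - q ^+ (N.+1 + n))) =
  lterm N n * ((1 + q ^+ (N.+1 - n)) * (1 + q ^+ (N.+1 + n))).
Proof.
move=> nN; rewrite /lterm addSn subSn //.
transitivity ((-1) ^+ n * ((poch_ratio (N + n).+1 * (1 - q ^+ (N + n).+1)) *
   (poch_ratio (N - n).+1 * (1 - q ^+ (N - n).+1)))); first by ring.
by rewrite !poch_ratioS; ring.
Qed.

(** The parts containing [finv (lden n)] agree on both sides; they are collected in [G]. What
    remains are plain sums of [lterm], which [alternating_sum] evaluates at [N] and [N.+1] with
    opposite signs. *)
Lemma lsum_rec N : lden N.+1 * lsum N.+1 = lnum N.+1 * lsum N.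
Proof.
pose s := (1 - x) * (1 - y).
pose G n := q ^+ n * (1 + q ^+ (N.+1 - n)) * (1 + q ^+ (N.+1 + n)) * finv (lden n).
have EL : lden N.+1 * lsum N.+1 = lden N.+1 * poch_ratio N.+1 ^+ 2 +
   2 * s * (q ^+ N.+1 * (\sum_(n < N.+1) lterm N.+1 n.+1) + \sum_(n < N) lterm N n.+1 * G n.+1).
  rewrite /lsum mulrDr; congr (_ + _); rewrite mulrCA; congr (_ * _).
  rewrite big_ord_recr [in RHS]big_ord_recr /=.
  rewrite !mulrDr !mulr_sumr addrAC -big_split /=; congr (_ + _); last first.
    (* The new top index leaves no remainder, because its factor 1 - q^0 vanishes. *)
    have := @lden_split N.+1 N.+1; rewrite subnn leqnn expr0 subrr mulr0 !mul0r addr0 => /(_ isT) H.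
    transitivity (lterm N.+1 N.+1 * (lden N.+1 * (q ^+ N.+1 * finv (lden N.+1)))); first by ring.
    by rewrite H mulrC.
  apply: eq_bigr => n _.
  have := @lden_split N.+1 n.+1; rewrite (leq_trans (ltn_ord n)) // => /(_ isT) H.
  transitivity (lterm N.+1 n.+1 * (lden N.+1 * (q ^+ n.+1 * finv (lden n.+1)))); first by ring.
  rewrite H /G mulrDr; congr (_ + _); first by ring.
  transitivity (lterm N.+1 n.+1 * ((1 - q ^+ (N.+1 - n.+1)) * (1 - q ^+ (N.+1 + n.+1))) * (q ^+ n.+1 * finv (lden n.+1))); first by ring.
  by rewrite lterm_rec //; ring.
have ER : lnum N.+1 * lsum N = lnum N.+1 * poch_ratio N ^+ 2 +
   2 * s * (- q ^+ N.+1 * (\sum_(n < N) lterm N n.+1) + \sum_(n < N) lterm N n.+1 * G n.+1).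
  rewrite /lsum mulrDr; congr (_ + _); rewrite mulrCA; congr (_ * _).
  rewrite !mulr_sumr -big_split /=; apply: eq_bigr => n _.
  have := @lnum_split N.+1 n.+1; move=> /(_ (leqW (ltn_ord n))) H.
  transitivity (lterm N n.+1 * (lnum N.+1 * (q ^+ n.+1 * finv (lden n.+1)))); first by ring.
  by rewrite H /G; ring.
rewrite EL ER.
have H0 : poch_ratio N ^+ 2 + 2 * (\sum_(n < N) lterm N n.+1) = (-1) ^+ N := alternating_sum N.
have H1 : poch_ratio N.+1 ^+ 2 + 2 * (\sum_(n < N.+1) lterm N.+1 n.+1) = (-1) ^+ N.+1 :=
  alternating_sum N.+1.
have Hab := poch_ratioS N.
move: H0 H1 Hab; rewrite (exprS (-1)) /lden /lnum /s.
move: (\sum_(n < N.+1) lterm _ _) (\sum_(n < N) lterm _ _) (\sum_(n < N) _ * G _) => S1 S0 T.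
move: (poch_ratio N) (poch_ratio N.+1) (q ^+ N.+1) ((-1) ^+ N) => a b Q e H0 H1 Hab.
have H : b ^+ 2 * (1 - Q) ^+ 2 = a ^+ 2 * (1 + Q) ^+ 2 by rewrite -!exprMn Hab.
have H01 : b ^+ 2 + 2 * S1 + (a ^+ 2 + 2 * S0) = 0 by rewrite H1 H0; ring.
have HH : (1 - x) * (1 - y) * Q * (b ^+ 2 + 2 * S1 + (a ^+ 2 + 2 * S0)) + b ^+ 2 * (1 - Q) ^+ 2
    = a ^+ 2 * (1 + Q) ^+ 2 by rewrite H01 H mulr0 add0r.
by apply: (lincomb2 (a := 1) (b := (Q ^+ 2 - Q) * b ^+ 2 - (Q ^+ 2 + Q) * a ^+ 2) HH xy1); ring.
Qed.

Lemma lsum_prod N : (\prod_(n < N) lden n.+1) * lsum N = \prod_(n < N) lnum n.+1.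
Proof.
elim: N => [|N IH]; first by rewrite /lsum !big_ord0 poch_ratio0; ring.
by rewrite !big_ord_recr /= -mulrA lsum_rec -IH; ring.
Qed.

Lemma poch_ratio_feq N n : (N <= n)%N -> feq N (qpoch 1 1 1 * poch_ratio n) (qpoch (-1) 1 1).
Proof.
move=> Nn; apply: feq_trans (feq_trans _ (feq_sym (@qpoch_feq (-1) 1 1 N n _ _))) => //; last lia.
rewrite -poch_ratioP; apply: feqM => //; apply: qpoch_feq => //; lia.
Qed.

(** With length [N + N], the first [N] summands have both indices of [poch_ratio] at least [N],
    where it has reached its limit; the later summands are divisible by [q ^+ N]. *)
Lemma lsum_feq N :
  feq N (qpoch 1 1 1 ^+ 2 * lsum (N + N))
   (qpoch (-1) 1 1 ^+ 2 * (1 + 2 * ((1 - x) * (1 - y)) *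
      \sum_(n < N) (-1) ^+ n.+1 * q ^+ n.+1 * finv (lden n.+1))).
Proof.
rewrite /lsum mulrDr [X in feq _ _ X]mulrDr [X in feq _ _ (X + _)]mulr1; apply: feqD.
  by rewrite -exprMn !expr2; apply: feqM; apply: poch_ratio_feq; rewrite leq_addr.
rewrite [X in feq _ X _]mulrCA [X in feq _ _ X]mulrCA; apply: feqM => //.
rewrite big_split_ord mulrDr /= !mulr_sumr -[X in feq _ _ X]addr0; apply: feqD.
  apply: feq_sum => n _.
  rewrite [X in feq _ X _](_ : _ = (qpoch 1 1 1 * poch_ratio (N + N + n.+1)) *
    (qpoch 1 1 1 * poch_ratio (N + N - n.+1)) * ((-1) ^+ n.+1 * q ^+ n.+1 * finv (lden n.+1))); last first.
    by rewrite /lterm; ring.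
  apply: feqM => //; rewrite expr2.
  by apply: feqM; apply: poch_ratio_feq; have := ltn_ord n; lia.
rewrite [X in feq _ _ X](_ : _ = \sum_(n < N) 0); last by rewrite big1.
apply: feq_sum => n _; rewrite -[_ * _ * finv _]mulrA mulrCA; apply: feq_qX; lia.
Qed.
End Lambert.

Lemma lden_prod c d N :
  \prod_(n < N) lden (fconst c) (fconst d) n.+1 = pochn c 1 1 N * pochn d 1 1 N.
Proof.
by rewrite /pochn -big_split /=; apply: eq_bigr => n _; rewrite mul1n add1n.
Qed.
Lemma lnum_prod c d N :
  \prod_(n < N) lnum (fconst c) (fconst d) n.+1 = pochn (- c) 1 1 N * pochn (- d) 1 1 N.
Proof.
rewrite /pochn -big_split /=; apply: eq_bigr => n _.
by rewrite mul1n add1n !rmorphN /= !mulNr !opprK.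
Qed.

Definition lambert (z : algC) : fps :=
  fsum1 (fun n => fscale ((1 - z) * (1 - z^-1) * (-1) ^+ n)
                         (fdiv (fqpow n) (fmul (fonem z n) (fonem (z^-1) n)))).

Lemma lambert_feq z N :
  feq N (lambert z) (((1 - fconst z) * (1 - fconst z^-1)) *
   \sum_(n < N) (-1) ^+ n.+1 * q ^+ n.+1 * finv (lden (fconst z) (fconst z^-1) n.+1)).
Proof.
move=> k kN; rewrite mulr_sumr fps_sumE /lambert /fsum1.
pose T n := fscale ((1 - z) * (1 - z^-1) * (-1) ^+ n)
                         (fdiv (fqpow n) (fmul (fonem z n) (fonem (z^-1) n))).
have TE n : T n = q ^+ n * ((1 - fconst z) * (1 - fconst z^-1) * (-1) ^+ n *
    finv (lden (fconst z) (fconst z^-1) n)).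
  rewrite /T fscaleE !rmorphM !rmorphB rmorph1 rmorphXn rmorphN1 /= !fonemE fqpowE.
  by rewrite -[fdiv _ _]/(_ * finv (_ * _)) /lden; ring.
rewrite -(big_mkord xpredT (fun n => ((1 - fconst z) * (1 - fconst z^-1) * ((-1) ^+ n.+1 * q ^+ n.+1 * finv (lden (fconst z) (fconst z^-1) n.+1))) k)).
(* [fsum1] stops at index [k] when it reads the coefficient of q^k; the further summands are
   O(q^(k+1)). *)
rewrite [RHS](@big_cat_nat _ _ _ k) ?(ltnW kN) //=.
rewrite [X in _ = _ + X]big_nat_cond [X in _ = _ + X]big1 ?addr0.
  rewrite big_add1 /=; apply: eq_bigr => n _; rewrite -/(T n.+1) TE.
  by apply: (congr1 (fun f : fps => f k)); ring.
move=> n; rewrite andbT => /andP [kn _].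
transitivity (T n.+1 k); last by rewrite TE (@feq_qX k.+1).
by apply: (congr1 (fun f : fps => f k)); rewrite TE; ring.
Qed.

(** The limit of [lsum_prod] at x = z and y = 1/z, multiplied by (q;q)_oo^2. *)
Lemma lambert_product (z : algC) : z != 0 ->
  qpoch z 1 1 * qpoch z^-1 1 1 * (qpoch (-1) 1 1 ^+ 2 * (1 + 2 * lambert z)) =
  qpoch 1 1 1 ^+ 2 * (qpoch (- z) 1 1 * qpoch (- z^-1) 1 1).
Proof.
move=> z0; apply: feq_eq => N.
have xy1 : fconst z * fconst z^-1 = 1 by rewrite -rmorphM mulfV // rmorph1.
have qE c : feq N (qpoch c 1 1) (pochn c 1 1 (N + N)) by apply: qpoch_feq => //; lia.
apply: feq_trans (feq_sym (feqM (@feq_refl N (qpoch 1 1 1 ^+ 2)) _)); last by apply: feqM; apply: qE.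
rewrite -lnum_prod -(lsum_prod xy1) lden_prod [X in feq _ _ X]mulrCA.
apply: feqM; first by apply: feqM; apply: qE.
apply: feq_trans (feq_sym (@lsum_feq _ _ N)).
apply: feqM => //; apply: feqD => //; rewrite -mulrA; apply: feqM => //.
exact: lambert_feq.
Qed.

(** * The Jacobi triple product *)

Section FiniteTriple.
Variables (m : nat) (X Y : fps).
Hypothesis m0 : (0 < m)%N.
Let Q := q ^+ m.
Hypothesis XY : X * Y = Q.

Let P n := pochn 1 m m n.
(* The central q-binomial coefficient [2N choose N + n] in base q^m. *)
Definition gcoef N n : fps :=
  if (n <= N)%N then P (N + N) * finv (P (N - n)) * finv (P (N + n)) else 0.

Lemma euler_at0 n : P n 0%N != 0. Proof. by rewrite /P pochn_at0 ?oner_eq0. Qed.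

Lemma euler_rec n : P n.+1 = P n * (1 - Q ^+ n.+1).
Proof. by rewrite /P pochnS rmorph1 mul1r -mulnS /Q exprM. Qed.

Lemma finv_euler_rec n : finv (P n) = finv (P n.+1) * (1 - Q ^+ n.+1).
Proof.
apply: (fps_mulIf (euler_at0 n.+1)); rewrite mulrA finvP ?euler_at0 // euler_rec mulrAC.
by rewrite finvP ?euler_at0.
Qed.

Section Rec.
Variables (N n : nat).
Hypothesis nN : (n <= N.+1)%N.
Let A := finv (P (N.+1 - n)).
Let B := finv (P (N.+1 + n)).

(** This lemma and the next two write neighbouring coefficients over the common [A] and [B], so that
    the recurrence becomes a polynomial identity. Out of range, a factor 1 - Q^0 reproduces the
    default value 0 of [gcoef]. *)
Lemma gcoef_mid :
  gcoef N n = P (N + N) * A * B * (1 - Q ^+ (N.+1 - n)) * (1 - Q ^+ (N.+1 + n)).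
Proof.
rewrite /gcoef; case: leqP => nN'; last first.
  by rewrite (_ : N.+1 - n = 0)%N ?expr0; [ring|lia].
by rewrite finv_euler_rec (finv_euler_rec (N + n)) /A /B subSn // addSn; ring.
Qed.

Lemma gcoef_up :
  gcoef N n.+1 = P (N + N) * A * B * (1 - Q ^+ (N.+1 - n)) * (1 - Q ^+ (N - n)).
Proof.
rewrite /gcoef; case: ltnP => nN'; last first.
  by rewrite (_ : N - n = 0)%N ?expr0; [ring|lia].
rewrite finv_euler_rec (finv_euler_rec (N - n.+1).+1) /A /B addSnnS.
have -> : ((N - n.+1).+2 = N.+1 - n)%N by lia.
by rewrite (_ : (N - n.+1).+1 = N - n)%N; [ring|lia].
Qed.

Lemma gcoef_top : gcoef N.+1 n =
  P (N + N) * A * B * ((1 - Q ^+ (N + N).+1) * (1 - Q ^+ (N + N).+2)).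
Proof.
have PE : P (N.+1 + N.+1) = P (N + N) * (1 - Q ^+ (N + N).+1) * (1 - Q ^+ (N + N).+2).
  by rewrite -!euler_rec addSn addnS.
by rewrite /gcoef nN PE /A /B; ring.
Qed.
End Rec.

Lemma gcoef_down N n : (n <= N)%N -> gcoef N n =
  P (N + N) * finv (P (N.+1 - n.+1)) * finv (P (N.+1 + n.+1)) *
  (1 - Q ^+ (N + n.+1)) * (1 - Q ^+ (N.+1 + n.+1)).
Proof.
move=> nN; rewrite /gcoef nN subSS (finv_euler_rec (N + n)) (finv_euler_rec (N + n).+1).
by rewrite !addSn !addnS; ring.
Qed.

(** Two steps of the q-Pascal rule, from row 2N to row 2N + 2. *)
Lemma gcoef_rec N n : (n <= N)%N ->
  gcoef N.+1 n.+1 = (1 + Q ^+ (N + N).+1) * gcoef N n.+1 +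
    Q ^+ (N - n) * gcoef N n + Q ^+ (N + n.+2) * gcoef N n.+2.
Proof.
move=> nN; rewrite gcoef_top // gcoef_mid // gcoef_up // gcoef_down //.
move: (P _) (finv _) (finv _) => p A B.
(* At [n = N] the subtraction [N - n.+1] is truncated, so this boundary case is computed apart. *)
case: (ltnP n N) => [nN'|Nn].
  have -> : (N.+1 - n.+1 = (N - n.+1).+1)%N by lia.
  have -> : (N - n = (N - n.+1).+1)%N by lia.
  have -> : ((N + N).+1 = (N - n.+1 + (N + n.+1)).+1)%N by lia.
  rewrite !addSn !addnS !exprS !exprD; move: (Q ^+ (N - _)) => u.
  by ring.
have -> : n = N by lia.
by rewrite !subnn (_ : N - N.+1 = 0)%N ?expr0 ?addSn ?addnS ?exprS ?exprD; [ring|lia].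
Qed.

(** At the centre the two outer neighbours coincide by symmetry, hence the factor 2. *)
Lemma gcoef_rec0 N : gcoef N.+1 0 =
  (1 + Q ^+ (N + N).+1) * gcoef N 0 + 2 * Q ^+ N.+1 * gcoef N 1.
Proof.
rewrite gcoef_top // gcoef_mid // gcoef_up // !addn0 !subn0.
by rewrite !exprS !exprD; ring.
Qed.

(** The terms of index n and -n of the bilateral series, paired so that only natural indices occur;
    the sign is kept outside. *)
Let T n : fps := (X ^+ n + Y ^+ n) * Q ^+ 'C(n, 2).

Lemma triple_term_rec n : (X + Y) * T n.+1 * Q ^+ n.+1 = T n.+2 + Q ^+ (n.+1 + n.+1) * T n.
Proof.
rewrite /T !binS !bin0 !bin1 !addn1 !exprD !exprS -XY; ring.
Qed.

Definition triple_sum N := gcoef N 0 + \sum_(n < N) (-1) ^+ n.+1 * (gcoef N n.+1 * T n.+1).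

(** In [gcoef_rec] the middle neighbour accounts for 1 + Q^(2N+1). The outer two, after a shift of
    index, combine through [triple_term_rec] into the remaining part -(X + Y) Q^N of the two new
    factors. *)
Lemma triple_sum_rec N :
  (1 - X * Q ^+ N) * (1 - Y * Q ^+ N) * triple_sum N = triple_sum N.+1.
Proof.
pose h n := (-1) ^+ n * (gcoef N n * T n).
have hbig n : (N < n)%N -> h n = 0.
  by move=> Nn; rewrite /h /gcoef leqNgt Nn mul0r mulr0.
have -> : triple_sum N = gcoef N 0 + \sum_(n < N.+1) h n.+1.
  by rewrite big_ord_recr /= hbig // addr0.
have -> : triple_sum N.+1 = gcoef N.+1 0 + \sum_(n < N.+1) ((1 + Q ^+ (N + N).+1) * h n.+1
    + (-1) ^+ n.+1 * Q ^+ (N - n) * gcoef N n * T n.+1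
    + (-1) ^+ n.+1 * Q ^+ (N + n.+2) * gcoef N n.+2 * T n.+1).
  congr (_ + _); apply: eq_bigr => n _; rewrite gcoef_rec ?leq_ord // /h; ring.
have -> : (1 - X * Q ^+ N) * (1 - Y * Q ^+ N) = 1 + Q ^+ (N + N).+1 - (X + Y) * Q ^+ N.
  by rewrite exprS exprD -XY; ring.
rewrite !big_split /= -mulr_sumr gcoef_rec0.
have E1 : \sum_(n < N.+1) (-1) ^+ n.+1 * Q ^+ (N - n) * gcoef N n * T n.+1 =
   - (gcoef N 0 * Q ^+ N * (X + Y)) - \sum_(n < N) (-1) ^+ n.+1 * Q ^+ (N - n.+1) * gcoef N n.+1 * T n.+2.
  rewrite big_ord_recl subn0 /= -sumrN; congr (_ + _).
    by rewrite /T /= bin_small // !expr1; ring.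
  by apply: eq_bigr => n _; rewrite /bump add1n (exprS (-1) n.+1); ring.
have E2 : \sum_(n < N.+1) (-1) ^+ n.+1 * Q ^+ (N + n.+2) * gcoef N n.+2 * T n.+1 =
   - 2 * Q ^+ N.+1 * gcoef N 1 - \sum_(n < N.+1) (-1) ^+ n.+1 * Q ^+ (N + n.+1) * gcoef N n.+1 * T n.
  rewrite [in RHS]big_ord_recl big_ord_recr /= {2}/gcoef leqNgt ltnW // mulr0 mul0r addr0.
  rewrite [- (_ + \sum_(i < N) _)]opprD addrA -sumrN /= /T /= !expr0 !expr1 addn1.
  rewrite [X in _ = X + _](_ : _ = 0) ?add0r; last by ring.
  by apply: eq_bigr => n _; rewrite /bump add1n (exprS (-1) n.+1); ring.
have E3 : (X + Y) * Q ^+ N * \sum_(n < N.+1) h n.+1 =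
   \sum_(n < N) (-1) ^+ n.+1 * Q ^+ (N - n.+1) * gcoef N n.+1 * T n.+2 +
   \sum_(n < N.+1) (-1) ^+ n.+1 * Q ^+ (N + n.+1) * gcoef N n.+1 * T n.
  rewrite !big_ord_recr /= hbig // addr0 {3}/gcoef ltnn mulr0 mul0r addr0.
  rewrite mulr_sumr -big_split /=; apply: eq_bigr => n _.
  have nN := ltn_ord n.
  have -> : Q ^+ N = Q ^+ (N - n.+1) * Q ^+ n.+1 by rewrite -exprD subnK.
  have -> : (N + n.+1 = (N - n.+1) + (n.+1 + n.+1))%N by lia.
  transitivity ((-1) ^+ n.+1 * gcoef N n.+1 * Q ^+ (N - n.+1) * ((X + Y) * T n.+1 * Q ^+ n.+1)).
    by rewrite /h; ring.
  by rewrite triple_term_rec !exprD; ring.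
rewrite E1 E2 mulrBl mulrDr [in X in _ - X]mulrDr E3.
by ring.
Qed.

(** The finite form of the Jacobi triple product. *)
Lemma triple_sumE N :
  \prod_(k < N) ((1 - X * Q ^+ k) * (1 - Y * Q ^+ k)) = triple_sum N.
Proof.
elim: N => [|N IH]; last by rewrite big_ord_recr /= IH mulrC triple_sum_rec.
rewrite /triple_sum !big_ord0 addr0 /gcoef /= {1}/P /pochn big_ord0 mul1r.
have P0 : P 0 = 1 by rewrite /P /pochn big_ord0.
by have := finvP (euler_at0 0); rewrite P0 mul1r => ->; ring.
Qed.
End FiniteTriple.

(** * Power series given by summable families, and theta series *)

(** Lists larger than the fibre are allowed, so that one list can serve all exponents up to a bound,
    as in [is_qsum_mul]. *)
Definition covers (I : eqType) (e : I -> nat) (N : nat) (s : seq I) :=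
  uniq s /\ forall i, e i = N -> i \in s.

(* f = sum_(i : I) c_i q^(e_i), where e has finite fibres: the coefficient of q^N is
   computed on any finite list containing the fibre of N. *)
Definition is_qsum (I : eqType) (e : I -> nat) (c : I -> algC) (f : fps) :=
  forall N, exists2 s, covers e N s & f N = \sum_(i <- s | e i == N) c i.

Lemma covers_sum (I : eqType) (e : I -> nat) (c : I -> algC) N s s' :
  covers e N s -> covers e N s' ->
  \sum_(i <- s | e i == N) c i = \sum_(i <- s' | e i == N) c i.
Proof.
move=> [us cs] [us' cs']; rewrite -[LHS]big_filter -[RHS]big_filter.
apply: perm_big; apply: uniq_perm; rewrite ?filter_uniq // => i.
by rewrite !mem_filter; case: eqP => //= ei; rewrite cs // cs'.
Qed.

(** The principle behind the theta identities below: after a change of index, both sides are sums of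
    the same family. *)
Lemma is_qsum_uniq (I : eqType) (e : I -> nat) (c : I -> algC) f g :
  is_qsum e c f -> is_qsum e c g -> f = g.
Proof.
move=> fs gs; apply: fpsP => N; have [s cs ->] := fs N; have [s' cs' ->] := gs N.
exact: covers_sum.
Qed.

Lemma eq_is_qsum (I : eqType) (e e' : I -> nat) (c c' : I -> algC) f :
  e =1 e' -> c =1 c' -> is_qsum e c f -> is_qsum e' c' f.
Proof.
move=> ee cc fs N; have [s [us cs] ->] := fs N; exists s.
  by split=> // i; rewrite -ee; apply: cs.
by apply: eq_big => i; rewrite ?ee // cc.
Qed.

Lemma is_qsum_reindex (I J : eqType) (h : J -> I) (h' : I -> J) e c f :
  cancel h h' -> cancel h' h -> is_qsum e c f -> is_qsum (e \o h) (c \o h) f.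
Proof.
move=> hK h'K fs N; have [s [us cs] ->] := fs N; exists (map h' s); first split.
- by rewrite map_inj_uniq //; apply: can_inj h'K.
- by move=> j /cs hj; rewrite -[j]hK map_f.
by rewrite big_map; apply: eq_big => i; rewrite /= h'K.
Qed.

Lemma is_qsum_scale (I : eqType) (e : I -> nat) c f k a :
  is_qsum e c f -> is_qsum (fun i => k + e i)%N (fun i => a * c i) (fconst a * q ^+ k * f).
Proof.
move=> fs N; have E : (fconst a * q ^+ k * f) N = if (k <= N)%N then a * f (N - k)%N else 0.
  rewrite -mulrA -fscaleE /fscale -fqpowE fps_mulE /fqpow; case: leqP => kN.
    rewrite (bigD1 (Ordinal (kN : (k < N.+1)%N))) //= eqxx mul1r big1 ?addr0 // => i.
    by rewrite -val_eqE /= => /negbTE ->; rewrite mul0r.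
  rewrite big1 ?mulr0 // => i _; rewrite ifN ?mul0r //.
  by have := ltn_ord i; case: eqP => // ->; rewrite ltnS leqNgt kN.
rewrite E; case: leqP => kN; last first.
  exists [::]; last by rewrite big_nil.
  by split=> // i ik; have := leq_addr (e i) k; rewrite ik leqNgt kN.
have [s [us cs] ->] := fs (N - k)%N; exists s.
  by split=> // i ik; apply: cs; rewrite -ik addKn.
rewrite mulr_sumr; apply: eq_bigl => i.
by rewrite -(eqn_add2l k) subnKC.
Qed.

Lemma is_qsum_mul (I J : eqType) (e : I -> nat) (e' : J -> nat) c c' f g :
  is_qsum e c f -> is_qsum e' c' g ->
  is_qsum (fun p => e p.1 + e' p.2)%N (fun p => c p.1 * c' p.2) (f * g).
Proof.
move=> fs gs N.
have cover (K : eqType) (u : K -> nat) (d : K -> algC) h : is_qsum u d h -> forall M,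
    exists s, forall k, (k <= M)%N -> covers u k s.
  move=> hs; elim=> [|M [s cs]].
    by have [s cs _] := hs 0%N; exists s => k; rewrite leqn0 => /eqP ->.
  have [s' [us' cs'] _] := hs M.+1; exists (undup (s ++ s')) => k kM.
  split; first exact: undup_uniq.
  move=> i ik; rewrite mem_undup mem_cat; case: (ltngtP k M.+1) kM => // [kM _|kM _].
    by have [_ ->] := cs k kM.
  by rewrite (cs' i) ?orbT // ik.
have [s cs] := cover _ _ _ _ fs N; have [s' cs'] := cover _ _ _ _ gs N.
have [us _] := cs 0%N (leq0n _); have [us' _] := cs' 0%N (leq0n _).
exists (allpairs (fun x y => (x, y)) s s'); first split.
- by apply: allpairs_uniq => // -[? ?] [? ?].
- case=> i j /= ij; apply/allpairsP; exists (i, j); split => //=.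
    by have [_ ->] := cs (e i) (leq_trans (leq_addr _ _) (eq_leq ij)).
  by have [_ ->] := cs' (e' j) (leq_trans (leq_addl _ _) (eq_leq ij)).
have fE k : (k <= N)%N -> f k = \sum_(i <- s | e i == k) c i.
  by move=> kN; have [t ct ->] := fs k; apply: covers_sum ct (cs k kN).
have gE k : (k <= N)%N -> g k = \sum_(i <- s' | e' i == k) c' i.
  by move=> kN; have [t ct ->] := gs k; apply: covers_sum ct (cs' k kN).
rewrite fps_mulE [RHS]big_mkcond [RHS]big_allpairs /=.
under [LHS]eq_bigr => k _ do rewrite fE ?leq_ord // gE ?leq_subr // big_mkcond mulr_suml.
rewrite exchange_big /=; apply: eq_bigr => i _.
(* For a fixed [i], only the summand [k = e i] of the convolution survives. *)
case: (leqP (e i) N) => eN.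
  rewrite (bigD1 (Ordinal (eN : (e i < N.+1)%N))) //= eqxx [X in _ + X]big1 ?addr0.
    rewrite mulr_sumr big_mkcond; apply: eq_bigr => j _.
    by rewrite -(eqn_add2l (e i) (e' j)) subnKC //.
  by move=> k; rewrite -val_eqE /= eq_sym => /negbTE ->; rewrite mul0r.
rewrite big1; last by move=> k _; case: eqP (ltn_ord k) eN => [->|]; rewrite ?mul0r // ltnS leqNgt => /negbTE ->.
rewrite big1 // => j _; case: eqP => // eij.
by have := leq_addr (e' j) (e i); rewrite eij leqNgt eN.
Qed.

Lemma is_qsum_sum (K : finType) (I : eqType) (e : K -> I -> nat) (c : K -> I -> algC)
    (f : K -> fps) : (forall k, is_qsum (e k) (c k) (f k)) ->
  is_qsum (fun p => e p.1 p.2) (fun p => c p.1 p.2) (\sum_k f k).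
Proof.
move=> fs N; rewrite fps_sumE.
have [s sP] : exists s : K -> seq I, forall k, covers (e k) N (s k).
  have : forall k, exists s, covers (e k) N s by move=> k; have [s] := fs k N; exists s.
  by move=> /choice [s sP]; exists s.
exists [seq (k, i) | k <- index_enum K, i <- s k]; first split.
- apply: allpairs_uniq_dep; first exact: index_enum_uniq.
    by move=> k _; have [] := sP k.
  by move=> [k i] [k' i'] /= _ _ [-> ->].
- case=> k i /= ki; apply/allpairsPdep; exists k, i; split=> //.
  by have [_ ->] := sP k.
rewrite [RHS]big_mkcond [RHS]big_allpairs_dep /=; apply: eq_bigr => k _.
have [t ct ->] := fs k N; rewrite (covers_sum _ ct (sP k)).
by rewrite big_mkcond.
Qed.

(* The exponent a n + (a + b) n (n - 1)/2, a natural number for every integer n. *)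
Definition texp (a b : nat) (n : int) : nat :=
  match n with
  | Posz n => a * n + (a + b) * 'C(n, 2)
  | Negz n => b * n.+1 + (a + b) * 'C(n.+1, 2)
  end.

Lemma bin2Z (n : nat) : ('C(n, 2))%:Z * 2 = n%:Z * (n%:Z - 1).
Proof.
case: n => [|n]; first by rewrite bin0n mul0r mul0r.
by rewrite bin2 -[2]/(2%:Z) -PoszM muln2 halfK oddM /= andNb subn0; lia.
Qed.

(** Doubled and read in the integers, the exponent is one polynomial for both signs of [n], so
    equalities of exponents can be left to [ring]. *)
Lemma texpE (a b : nat) (n : int) :
  (texp a b n)%:Z * 2 = 2 * a%:Z * n + (a%:Z + b%:Z) * n * (n - 1).
Proof.
case: n => n /=.
  have H := bin2Z n; apply: (lincomb2 (a := a%:Z + b%:Z) (b := 0) H H).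
  by rewrite PoszD !PoszM PoszD; ring.
have H := bin2Z n.+1; apply: (lincomb2 (a := a%:Z + b%:Z) (b := 0) H H).
by rewrite NegzE PoszD !PoszM PoszD; ring.
Qed.

Definition is_theta (y : algC) (a b : nat) := is_qsum (texp a b) (fun n : int => (- y) ^ n).

(** The limit of [triple_sumE] multiplied by (q^m;q^m)_oo: this factor times [gcoef m N n] tends to
    1. *)
Lemma jtp (y : algC) (a b : nat) : y != 0 -> (0 < a + b)%N ->
  is_theta y a b (qpoch y a (a + b) * qpoch y^-1 b (a + b) * qpoch 1 (a + b) (a + b)).
Proof.
move=> y0 m0 M; pose m := (a + b)%N.
pose X := fconst y * q ^+ a; pose Y := fconst y^-1 * q ^+ b.
have XY : X * Y = q ^+ m.
  rewrite /X /Y /m exprD mulrACA -rmorphM mulfV // rmorph1 mul1r //.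
(* For indices up to [K] one has N - n >= K > M, so the finite products are stable up to q^M;
   indices beyond [K] have exponents above [M]. *)
have [K KE] : exists K, K = M.+2 by exists M.+2.
pose N := (K + K)%N.
pose pos n := fconst ((- y) ^+ n) * q ^+ (a * n + m * 'C(n, 2)).
pose neg n := fconst ((- y) ^- n) * q ^+ (b * n + m * 'C(n, 2)).
have posE n : (-1) ^+ n * (X ^+ n * (q ^+ m) ^+ 'C(n, 2)) = pos n.
  rewrite /pos (exprNn y) rmorphM rmorphXn rmorphN1 /= rmorphXn /X exprMn -!exprM.
  by rewrite exprD; ring.
have negE n : (-1) ^+ n * (Y ^+ n * (q ^+ m) ^+ 'C(n, 2)) = neg n.
  rewrite /neg -exprVn invrN (exprNn y^-1) rmorphM rmorphXn rmorphN1 /= rmorphXn /Y exprMn -!exprM.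
  by rewrite exprD; ring.
have main : feq M.+1 (qpoch y a m * qpoch y^-1 b m * qpoch 1 m m)
    (1 + \sum_(n < K) (pos n.+1 + neg n.+1)).
  have prodE : feq M.+1 (qpoch y a m * qpoch y^-1 b m) (triple_sum m X Y N).
    rewrite -triple_sumE // big_split /=; apply: feqM.
      apply: (feq_trans (@qpoch_feq _ _ _ _ N _ _)) => //; first by rewrite /N KE; nia.
      rewrite /pochn (eq_bigr (fun k : 'I_N => 1 - X * (q ^+ m) ^+ k)) // => k _.
      by rewrite /X exprD exprM mulrA.
    apply: (feq_trans (@qpoch_feq _ _ _ _ N _ _)) => //; first by rewrite /N KE; nia.
    rewrite /pochn (eq_bigr (fun k : 'I_N => 1 - Y * (q ^+ m) ^+ k)) // => k _.
    by rewrite /Y exprD exprM mulrA.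
  have gE n : (n <= K)%N -> feq M.+1 (qpoch 1 m m * gcoef m N n) 1.
    move=> nK; have nN : (n <= N)%N by rewrite /N; lia.
    have u0 : qpoch 1 m m 0%N != 0 by rewrite qpoch_eq0 ?oner_eq0.
    apply: (feq_mulIf u0); rewrite mulr1.
    have PE k : (M < k)%N -> feq M.+1 (qpoch 1 m m) (pochn 1 m m k).
      by move=> Mk; apply: qpoch_feq => //; nia.
    apply: feq_trans (feq_sym (PE (N + N)%N _)); last by rewrite /N KE; lia.
    (* With a second factor (q^m;q^m)_oo inserted, the claim is the definition of the central
       coefficient, its three finite products being replaced by their common limit. *)
    have -> : pochn 1 m m (N + N) = pochn 1 m m (N - n) * (pochn 1 m m (N + n) * gcoef m N n).
      rewrite /gcoef nN; set p1 := pochn 1 m m (N - n); set p2 := pochn 1 m m (N + n).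
      transitivity (pochn 1 m m (N + N) * (p1 * finv p1) * (p2 * finv p2)).
        by rewrite !finvP ?euler_at0 // !mulr1.
      by ring.
    apply: feqM; first by apply: PE; rewrite /N KE; lia.
    by apply: feqM => //; apply: PE; rewrite /N KE; lia.
  apply: feq_trans (feqM prodE (@feq_refl _ _)) _.
  rewrite mulrC /triple_sum mulrDr; apply: feqD; first exact: gE.
  rewrite mulr_sumr {2}/N big_split_ord /= -[X in feq _ _ X]addr0; apply: feqD.
    apply: feq_sum => n _; rewrite -posE -negE.
    rewrite [X in feq _ X _](_ : _ = qpoch 1 m m * gcoef m N n.+1 *
      ((-1) ^+ n.+1 * ((X ^+ n.+1 + Y ^+ n.+1) * (q ^+ m) ^+ 'C(n.+1, 2)))); last by ring.
    rewrite [X in feq _ _ X](_ : _ = 1 *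
      ((-1) ^+ n.+1 * ((X ^+ n.+1 + Y ^+ n.+1) * (q ^+ m) ^+ 'C(n.+1, 2)))); last by ring.
    by apply: feqM => //; apply: gE.
  rewrite [X in feq _ _ X](_ : _ = \sum_(n < K) 0); last by rewrite big1.
  apply: feq_sum => n _; set k := (K + n).+1.
  rewrite [X in feq _ X _](_ : _ = q ^+ (m * 'C(k, 2)) * (qpoch 1 m m * ((-1) ^+ k *
     (gcoef m N k * (X ^+ k + Y ^+ k))))); last by rewrite exprM; ring.
  apply: feq_qX; rewrite /k binS bin1; have m1 : (0 < m)%N := m0; nia.
(* The integers from -K to K, as [Negz n] is -(n+1). *)
pose s := [seq Posz n | n <- index_iota 0 K.+1] ++ [seq Negz n | n <- index_iota 0 K].
exists s.
  split.
    rewrite cat_uniq !map_inj_uniq ?iota_uniq ?andbT //=; try by move=> ? ? [].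
    by apply/hasPn => _ /mapP [n _ ->]; apply/negP => /mapP [].
  rewrite /s; case=> n; rewrite mem_cat /texp => nM.
    rewrite map_f // mem_index_iota ltnNge; apply/negP => Kn.
    by case: n nM Kn => [|n]; rewrite ?binS ?bin1; nia.
  rewrite [X in _ || X]map_f ?orbT // mem_index_iota ltnNge; apply/negP => Kn.
  by move: nM Kn; rewrite binS bin1; nia.
rewrite main // /s big_cat !big_map /=.
have cE (c : algC) e : (fconst c * q ^+ e) M = if e == M then c else 0.
  by rewrite -fscaleE -fqpowE /fscale /fqpow eq_sym; case: eqP; rewrite ?mulr1 ?mulr0.
rewrite big_split /= addrA.
have -> : 1 + \sum_(n < K) pos n.+1 = \sum_(n < K.+1) pos n.
  rewrite [RHS]big_ord_recl; congr (_ + _).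
  by rewrite /pos muln0 bin0n muln0 !expr0 rmorph1 mulr1.
rewrite -[LHS]/((_ : fps) M + (_ : fps) M) !fps_sumE; congr (_ + _).
  rewrite big_mkord [RHS]big_mkcond.
  by apply: eq_bigr => n _; rewrite /pos cE.
rewrite big_mkord [RHS]big_mkcond.
by apply: eq_bigr => n _; rewrite /neg cE.
Qed.

(** * The ring morphisms q -> q^d *)

Lemma is_qsum_id (f : fps) : is_qsum id f f.
Proof.
move=> N; exists [:: N]; last by rewrite big_cons big_nil eqxx addr0.
by split=> // i ->; rewrite mem_head.
Qed.

Lemma is_qsum_dil (I : eqType) (e : I -> nat) c f d :
  is_qsum e c f -> is_qsum (fun i => d.+1 * e i)%N c (fdil d.+1 f).
Proof.
move=> fs N; rewrite /fdil; case: ifP => dN.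
  have [s [us cs] ->] := fs (N %/ d.+1)%N; exists s.
    by split=> // i ei; apply: cs; rewrite -ei mulKn.
  apply: eq_bigl => i; apply/eqP/eqP => [->|<-]; last by rewrite mulKn.
  by rewrite mulnC divnK.
exists [::]; last by rewrite big_nil.
by split=> // i ei; rewrite -ei dvdn_mulr in dN.
Qed.

Fact fdil_zmod d : zmod_morphism (fdil d.+1).
Proof.
move=> f g; apply: fpsP => n; rewrite -[RHS]/(fdil d.+1 f n - fdil d.+1 g n) /fdil.
by case: ifP; rewrite ?subr0.
Qed.
Fact fdil_monoid d : monoid_morphism (fdil d.+1).
Proof.
split=> [|f g].
  apply: fpsP => -[|n]; first by rewrite /fdil dvdn0 div0n.
  rewrite /fdil; case: ifP => // dn; rewrite -[LHS]/(if _ == 0%N then 1 else 0) ifN //.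
  by rewrite -lt0n divn_gt0 // dvdn_leq.
(* Both sides are the sum of f_i g_j q^((d+1)(i+j)) over all pairs (i, j). *)
apply: is_qsum_uniq (is_qsum_dil d (is_qsum_mul (is_qsum_id f) (is_qsum_id g))) _.
apply: eq_is_qsum (is_qsum_mul (is_qsum_dil d (is_qsum_id f)) (is_qsum_dil d (is_qsum_id g))) => //.
by move=> p /=; rewrite mulnDr.
Qed.
HB.instance Definition _ d := GRing.isZmodMorphism.Build fps fps (fdil d.+1) (fdil_zmod d).
HB.instance Definition _ d := GRing.isMonoidMorphism.Build fps fps (fdil d.+1) (fdil_monoid d).

Lemma fdil_const d c : fdil d.+1 (fconst c) = fconst c.
Proof.
apply: fpsP => -[|n]; first by rewrite /fdil dvdn0 div0n.
rewrite /fdil; case: ifP => // dn; rewrite /fconst ifN //.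
by rewrite -lt0n divn_gt0 // dvdn_leq.
Qed.

Lemma fdil_q d : fdil d.+1 q = q ^+ d.+1.
Proof.
rewrite -fqpowE; apply: fpsP => n; rewrite /fdil /fqpow.
case: ifP => [/dvdnP [k ->]|dn]; first by rewrite mulnK // -{2}[d.+1]mul1n eqn_pmul2r.
by case: eqP => // nd; rewrite nd dvdnn in dn.
Qed.

Lemma fdil_feq d N f g : feq N f g -> feq N (fdil d.+1 f) (fdil d.+1 g).
Proof.
move=> fg k kN; rewrite /fdil; case: ifP => // _; apply: fg.
exact: leq_ltn_trans (leq_div _ _) kN.
Qed.

Lemma fdil_qpoch d c a m : (0 < m)%N ->
  fdil d.+1 (qpoch c a m) = qpoch c (d.+1 * a) (d.+1 * m).
Proof.
move=> m0; apply: feq_eq => N.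
apply: (feq_trans (@fdil_feq d _ _ _ (@qpoch_feqW c a m N m0))).
apply: (feq_trans _ (feq_sym (@qpoch_feqW c _ _ N _))); last by rewrite muln_gt0.
rewrite /pochn rmorph_prod; apply: feq_prod => k _.
by rewrite rmorphB rmorph1 rmorphM rmorphXn /= fdil_const fdil_q -exprM mulnDr mulnA.
Qed.

Lemma texp_inj (x y : nat) : x%:Z * 2 = y%:Z * 2 -> x = y.
Proof. lia. Qed.

(* Substitute (i, j) = (s + t, s - t + eps), eps = 0 or 1, in the double sum over
   (i, j); the exponents are stated without subtraction. *)
Lemma theta_mul (u u' v v' w w' x x' m : nat) f1 f2 fa ga fb gb :
  (u + u' = m)%N -> (v + v' = m)%N -> (u + v + m = w)%N -> (w + w' = m + m)%N ->
  (x + v = u)%N -> (x + x' = m + m)%N ->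
  is_theta 1 u u' f1 -> is_theta 1 v v' f2 ->
  is_theta (-1) (u + v) (u' + v') fa -> is_theta (-1) (u + v') (u' + v) gb ->
  is_theta (-1) w w' ga -> is_theta (-1) x x' fb ->
  f1 * f2 = fa * gb - q ^+ v * (ga * fb).
Proof.
move=> um vm wm ww xv xx t1 t2 tfa tgb tga tfb.
pose h (p : bool * (int * int)) : int * int := (p.2.1 + p.2.2, p.2.1 - p.2.2 + (p.1 : nat)%:Z).
pose h' (p : int * int) : bool * (int * int) :=
  let s := ((p.1 + p.2) %/ 2)%Z in (((p.1 + p.2) %% 2)%Z == 1, (s, p.1 - s)).
have hK : cancel h h'.
  case=> [[] [s t]] /=; rewrite /h' /=; congr (_, (_, _)); lia.
have h'K : cancel h' h.
  case=> [i j]; rewrite /h /h' /=; congr (_, _); first lia.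
  case: eqP => /=; lia.
(* The shift by [v] for eps = 1 is the exponent at (i, j) = (0, 1), the image of s = t = 0. The sign
   (-1)^(i+j) equals (-1)^eps, so the four factors have only positive terms, that is, they are
   thetas at y = -1. *)
pose F (b : bool) := if b then fconst (-1) * q ^+ v * (ga * fb) else fconst 1 * q ^+ 0 * (fa * gb).
pose E (b : bool) (p : int * int) := if b then (v + (texp w w' p.1 + texp x x' p.2))%N
  else (0 + (texp (u + v) (u' + v') p.1 + texp (u + v') (u' + v) p.2))%N.
pose C (b : bool) (p : int * int) : algC := if b then -1 * ((- -1) ^ p.1 * (- -1) ^ p.2)
  else 1 * ((- -1) ^ p.1 * (- -1) ^ p.2).
have FE : \sum_(b : bool) F b = fa * gb - q ^+ v * (ga * fb).
  by rewrite big_bool /F rmorphN1 rmorph1 /=; ring.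
rewrite -FE; have FS b : is_qsum (E b) (C b) (F b).
  by case: b; apply: is_qsum_scale; apply: is_qsum_mul.
have LS := is_qsum_reindex hK h'K (is_qsum_mul t1 t2).
apply: is_qsum_uniq LS _; apply: eq_is_qsum (is_qsum_sum FS).
  have uZ : u'%:Z = m%:Z - u%:Z by lia.
  have vZ : v'%:Z = m%:Z - v%:Z by lia.
  have wZ : w%:Z = u%:Z + v%:Z + m%:Z by lia.
  have wZ' : w'%:Z = m%:Z - u%:Z - v%:Z by lia.
  have xZ : x%:Z = u%:Z - v%:Z by lia.
  have xZ' : x'%:Z = 2 * m%:Z - u%:Z + v%:Z by lia.
  case=> [[] [s t]]; rewrite /E /h /=; apply: texp_inj;
    rewrite !PoszD !mulrDl !texpE ?PoszD ?wZ ?wZ' ?xZ ?xZ' ?uZ ?vZ; ring.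
case=> [[] [s t]]; rewrite /C /h /= !opprK !exp1rz ?addr0 !mulr1.
  rewrite -expfzDr ?oppr_eq0 ?oner_eq0 // (_ : s + t + (s - t + 1) = 2 * s + 1); last by ring.
  by rewrite expfzDr ?oppr_eq0 ?oner_eq0 // -exprz_exp -exprnP sqrrN expr1n !exp1rz mul1r.
rewrite -expfzDr ?oppr_eq0 ?oner_eq0 // (_ : s + t + (s - t) = 2 * s); last by ring.
by rewrite -exprz_exp -exprnP sqrrN expr1n !exp1rz.
Qed.

(* The index is written n = 5 m + (k - 1), so that the five theta series have linear
   coefficients k + 1 between 1 and 5. *)
Lemma theta_dissection (y : algC) f (t : 'I_5 -> fps) : y != 0 ->
  is_theta y 0 1 f -> (forall k : 'I_5, is_theta (y ^+ 5) k.+1 (4 - k) (t k)) ->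
  f = \sum_(k < 5) fconst ((- y) ^ (k%:Z - 1)) * q ^+ texp 0 1 (k%:Z - 1) * fdil 5 (t k).
Proof.
move=> y0 tf tt.
pose h (p : 'I_5 * int) : int := 5 * p.2 + (p.1%:Z - 1).
pose h' (n : int) : 'I_5 * int := (inord `|((n + 1) %% 5)%Z|%N, ((n + 1) %/ 5)%Z).
have hK : cancel h h'.
  case=> [k n]; rewrite /h /h' /=; have k5 := ltn_ord k; congr (_, _); last lia.
  by apply: val_inj; rewrite /= inordK; lia.
have h'K : cancel h' h.
  by move=> n; rewrite /h /h' /= inordK; lia.
have LS := is_qsum_reindex hK h'K tf.
apply: is_qsum_uniq LS _.
have FS (k : 'I_5) := is_qsum_scale (texp 0 1 (k%:Z - 1)) ((- y) ^ (k%:Z - 1)) (is_qsum_dil 4 (tt k)).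
apply: eq_is_qsum (is_qsum_sum FS); case=> [k n] /=; rewrite /h /=.
  have k5 := ltn_ord k; have kZ : (4 - k)%N%:Z = 4 - k%:Z by lia.
  apply: texp_inj; rewrite PoszD mulrDl PoszM -mulrA !texpE kZ -[k.+1]addn1 PoszD; ring.
have y0' : - y != 0 by rewrite oppr_eq0.
rewrite [RHS]expfzDr // [LHS]mulrC -exprz_exp -exprnP; congr (_ ^ _ * _).
by rewrite exprNn -signr_odd /= expr1 mulN1r.
Qed.

(** * The algebraic identity behind the dissection *)

(* p_a, p_5 and t stand for (q^a, q^(10-a); q^10), (q^5; q^10) and (q^10; q^10), so that
   J_a = p_a t and J_5 = p_5^2 t; i_a is the inverse of p_a.  W2 and W3 are the two
   Weierstrass relations with the powers of t cancelled. *)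
Section Level10.
Variable R : comNzRingType.
Variables p1 p2 p3 p4 p5 t i1 i2 i3 i4 i5 Q w h : R.
Hypotheses (e1 : p1 * i1 = 1) (e2 : p2 * i2 = 1) (e3 : p3 * i3 = 1)
  (e4 : p4 * i4 = 1) (e5 : p5 * i5 = 1) (eh : 2 * h = 1) (ew : w ^+ 2 = 1 - w).
Hypothesis W2 : p2 ^+ 2 * p3 * p5 ^+ 2 = p1 * p3 * p4 ^+ 2 + Q * p1 ^+ 2 * p2 * p4.
Hypothesis W3 : p1 * p4 ^+ 2 * p5 ^+ 2 = p2 * p3 ^+ 2 * p4 - Q * p1 * p2 ^+ 2 * p3.

Let E1 := p1 * p2 * p3 * p4 * p5 * t.
Let E2 := p2 * p4 * t.
Let A := p2 * p3 * p5 * t.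
Let B := p1 * p4 * p5 * t.
Let A' := p4 * i2 * i3 * p5 * t.
Let B' := p2 * i1 * i4 * p5 * t.
Let C' := 2 * i5 * t.
Let D := p4 * t.
Let F := p2 * t.
Let b0 := h * p5 ^+ 2 * t * p4 * i2 ^+ 2 * i3 ^+ 2 + w * (Q * t * i3 * i4).
Let b1 := (w - 1) * (p4 * t * i2 ^+ 2 * i3).
Let b2 := (1 - 2 * w) * (t * i1 * i4).
Let b3 := - (t * i2 * i3).
Let b4 := w * (p2 * t * i1 * i4 ^+ 2).

Let c0 := p5 ^+ 2 * t * p4 * i2 ^+ 2 * i3 ^+ 2 + 2 * w * (Q * t * i3 * i4).
(** Doubling removes the half, so that the certificates below need not involve [h]. *)
Lemma b0E : 2 * b0 = c0.
Proof.
by rewrite /b0 /c0; transitivity (2 * h * (p5 ^+ 2 * t * p4 * i2 ^+ 2 * i3 ^+ 2) + 2 * w * (Q * t * i3 * i4)); [|rewrite eh]; ring.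
Qed.

(** With x^5 = Q, this is the part of [dissected_identity] in powers of x divisible by 5; the next
    four lemmas treat the classes 1 to 4. Each difference of sides is an explicit combination of
    [W2] and [W3], once [e1] to [e5] clear the inverses. *)
Lemma residue0 : E2 * (A ^+ 3 * A' + Q * A * B ^+ 2 * C') =
  2 * E1 ^+ 2 * (D ^+ 2 * b0 - Q * D * F * b3 - Q * F ^+ 2 * b1).
Proof.
rewrite [RHS](_ : _ = E1 ^+ 2 * (D ^+ 2 * (2 * b0) - 2 * (Q * D * F * b3 + Q * F ^+ 2 * b1))); last by ring.
rewrite b0E.
apply: (lincomb2 (a := p2 * p3 * p4 ^+ 2 * p5 ^+ 2 * t ^+ 5)
  (b := - (p1 * p4 ^+ 3 * p5 ^+ 2 * t ^+ 5)) W2 W3).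
rewrite /E1 /E2 /A /B /A' /C' /D /F /c0 /b1 /b3; ring: e1 e2 e3 e4 e5.
Qed.

Lemma residue1 : E2 * ((w - 1) * (A ^+ 3 * B' + A ^+ 2 * B * A') + Q * (1 - w) * B ^+ 3 * C') =
  2 * E1 ^+ 2 * (D ^+ 2 * b1 - Q * D * F * b4 - Q * F ^+ 2 * b2).
Proof.
apply: (lincomb2 (a := i1 * (w - 1) * p5 ^+ 2 * t ^+ 5 * (p2 ^+ 3 * p3 ^+ 2 + 2 * p1 ^+ 2 * p4 ^+ 3))
  (b := - (i1 * (w - 1) * p5 ^+ 2 * t ^+ 5 * p1 * p2 ^+ 2 * p3 * p4)) W2 W3).
rewrite /E1 /E2 /A /B /A' /B' /C' /D /F /b1 /b2 /b4; ring: e1 e2 e3 e4 e5.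
Qed.

Lemma residue2 : E2 * ((2 - 3 * w) * A ^+ 2 * B * B' - (1 + w) * A * B ^+ 2 * A') =
  2 * E1 ^+ 2 * (D ^+ 2 * b2 - D * F * b0 - Q * F ^+ 2 * b3).
Proof.
rewrite [RHS](_ : _ = E1 ^+ 2 * (2 * D ^+ 2 * b2 - D * F * (2 * b0) - 2 * Q * F ^+ 2 * b3)); last by ring.
rewrite b0E.
apply: (lincomb2 (a := (2 - 3 * w) * p2 ^+ 2 * p3 * p4 * p5 ^+ 2 * t ^+ 5)
  (b := - (w * p1 * p2 * p4 ^+ 2 * p5 ^+ 2 * t ^+ 5)) W2 W3).
rewrite /E1 /E2 /A /B /A' /B' /D /F /c0 /b2 /b3; ring: e1 e2 e3 e4 e5.
Qed.

Lemma residue3 : E2 * (w * (A * B ^+ 2 * B' - B ^+ 3 * A' - A ^+ 3 * C')) =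
  2 * E1 ^+ 2 * (D ^+ 2 * b3 - D * F * b1 - Q * F ^+ 2 * b4).
Proof.
apply: (lincomb2 (a := - (i3 * w * p5 ^+ 2 * t ^+ 5 * p1 * p2 * p3 * p4 ^+ 2))
  (b := i3 * w * p5 ^+ 2 * t ^+ 5 * (2 * p2 ^+ 3 * p3 ^+ 2 - p1 ^+ 2 * p4 ^+ 3)) W2 W3).
rewrite /E1 /E2 /A /B /A' /B' /C' /D /F /b1 /b3 /b4; ring: e1 e2 e3 e4 e5.
Qed.

Lemma residue4 : E2 * ((1 - 2 * w) * (- (B ^+ 3 * B') - A ^+ 2 * B * C')) =
  2 * E1 ^+ 2 * (D ^+ 2 * b4 - D * F * b2 - F ^+ 2 * b0).
Proof.
rewrite [RHS](_ : _ = E1 ^+ 2 * (2 * D ^+ 2 * b4 - 2 * D * F * b2 - F ^+ 2 * (2 * b0))); last by ring.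
rewrite b0E.
apply: (lincomb2 (a := 0) (b := 2 * w * p1 * p2 ^+ 2 * p4 * p5 ^+ 2 * t ^+ 5) W2 W3).
rewrite /E1 /E2 /A /B /A' /B' /C' /D /F /c0 /b2 /b4; ring: e1 e2 e3 e4 e5.
Qed.

(** The residue identities summed with weights x^r. The factors on the left stand for T(z) T(z^2),
    T(z^2) and T(-z), those on the right for (q^2;q^2)_oo (q^10;q^10)_oo and the claimed dissection;
    [ew] reduces the powers of [w] that the expansion creates. *)
Lemma dissected_identity x : Q = x ^+ 5 ->
  E2 * ((A ^+ 2 - x * A * B - x ^+ 2 * B ^+ 2) * (A + w * x * B) *
        (A' + (w - 1) * x * B' - w * x ^+ 3 * C')) =
  2 * E1 ^+ 2 * ((D ^+ 2 - x ^+ 2 * D * F - x ^+ 4 * F ^+ 2) *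
        (b0 + x * b1 + x ^+ 2 * b2 + x ^+ 3 * b3 + x ^+ 4 * b4)).
Proof.
move=> Qq; move: residue0 residue1 residue2 residue3 residue4; rewrite Qq.
set L0 := E2 * _; set R0 := _ * (_ - x ^+ 5 * F ^+ 2 * b1) => r0.
set L1 := E2 * _; set R1 := _ * (_ - x ^+ 5 * F ^+ 2 * b2) => r1.
set L2 := E2 * _; set R2 := _ * (_ - x ^+ 5 * F ^+ 2 * b3) => r2.
set L3 := E2 * _; set R3 := _ * (_ - x ^+ 5 * F ^+ 2 * b4) => r3.
set L4 := E2 * _; set R4 := _ * (_ - F ^+ 2 * b0) => r4.
transitivity (L0 + x * L1 + x ^+ 2 * L2 + x ^+ 3 * L3 + x ^+ 4 * L4).
  rewrite /L0 /L1 /L2 /L3 /L4.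
  move: A B A' B' C' E2 => a b a' b' c' z; ring: ew.
rewrite r0 r1 r2 r3 r4 /R0 /R1 /R2 /R3 /R4.
move: b0 b1 b2 b3 b4 D F E1 => y0 y1 y2 y3 y4 d f z; ring.
Qed.
End Level10.

(** * Specialization to modulus 10 *)

Lemma qpoch0 c m : (0 < m)%N -> qpoch c 0 m = (1 - fconst c) * qpoch c m m.
Proof.
move=> m0; apply: feq_eq => N.
apply: (feq_trans (@qpoch_feq _ _ _ _ N.+1 _ _)) => //; first by nia.
rewrite /pochn big_ord_recl muln0 addn0 expr0 mulr1; apply: feqM => //.
apply: feq_sym; apply: (feq_trans (@qpoch_feqW _ _ _ _ m0)).
by apply: feq_prod => k _; rewrite /= /bump add1n add0n mulnS.
Qed.

Lemma qpoch_split d c a m : (0 < m)%N -> (0 < d)%N ->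
  qpoch c a m = \prod_(j < d) qpoch c (a + m * j) (m * d).
Proof.
move=> m0 d0; apply: feq_eq => N.
apply: (feq_trans (@qpoch_feq _ _ _ _ (d * N) _ _)) => //; first by rewrite mulnA (leq_trans (leq_pmull N _) (leq_addl _ _)) // muln_gt0 m0.
have -> : pochn c a m (d * N) = \prod_(j < d) pochn c (a + m * j) (m * d) N.
  elim: N => [|N IH]; first by rewrite muln0 /pochn big_ord0 big1 // => j _; rewrite big_ord0.
  under [RHS]eq_bigr => j _ do rewrite pochnS.
  rewrite mulnS addnC big_split /= -IH /pochn big_split_ord /=; congr (_ * _).
  by apply: eq_bigr => j _; congr (1 - _ * _ ^+ _); nia.
by apply: feq_prod => j _; apply: feq_sym; apply: qpoch_feqW; rewrite muln_gt0 m0.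
Qed.

Lemma qpoch_sqr c a m : (0 < m)%N ->
  qpoch c a m * qpoch (- c) a m = qpoch (c ^+ 2) (2 * a) (2 * m).
Proof.
move=> m0; apply: feq_eq => N.
apply: (feq_trans (feqM (@qpoch_feqW _ _ _ _ m0) (@qpoch_feqW _ _ _ _ m0))).
apply: feq_sym; apply: (feq_trans (@qpoch_feqW _ _ _ _ _)); first by rewrite muln_gt0.
rewrite /pochn -big_split /=; apply: feq_prod => k _.
by apply: eq_feq; rewrite -mulnA -mulnDr mulnC exprM rmorphN rmorphXn /=; ring.
Qed.

Lemma qpoch_unit c a m : (0 < a)%N -> (0 < m)%N -> qpoch c a m 0%N != 0.
Proof. by move=> a0 m0; rewrite qpoch_eq0 ?oner_eq0. Qed.

Lemma fdiv_eq (f g x : fps) : g 0%N != 0 -> g * x = f -> fdiv f g = x.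
Proof. by move=> g0 gx; apply: (fps_mulIf g0); rewrite fdivP. Qed.

Definition Jth (a : nat) : fps := qpoch 1 a 10 * qpoch 1 (10 - a) 10 * qpoch 1 10 10.

(** [thG a] is the sum of q^(10 n^2 + 2 a n) over the integers n; up to a fractional power of q,
    [thF a] is the same sum over n in Z + 1/2. *)
Definition thF (a : nat) : fps :=
  qpoch (-1) (2 * a) 20 * qpoch (-1) (20 - 2 * a) 20 * qpoch 1 20 20.
Definition thG (a : nat) : fps :=
  qpoch (-1) (10 + 2 * a) 20 * qpoch (-1) (10 - 2 * a) 20 * qpoch 1 20 20.

Lemma theta_bilinear (a b : nat) : (b <= a)%N -> (a + b <= 10)%N -> (a <= 5)%N ->
  Jth (a + b) * Jth (a - b) = thF a * thG b - q ^+ (a - b) * (thG a * thF b).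
Proof.
move=> ba ab a5; pose th (k l : nat) := qpoch (-1) k 20 * qpoch (-1) l 20 * qpoch 1 20 20.
have thP k l : (k + l = 20)%N -> is_theta (-1) k l (th k l).
  move=> kl; have := @jtp (-1) k l; rewrite kl invrN invr1 => H; apply: H => //.
  by rewrite oppr_eq0 oner_eq0.
have JP k : (k <= 10)%N -> is_theta 1 k (10 - k) (Jth k).
  move=> k10; have := @jtp 1 k (10 - k); rewrite subnKC // invr1 => H; apply: H => //.
  exact: oner_neq0.
apply: (@theta_mul (a + b) (10 - (a + b)) (a - b) (10 - (a - b)) (10 + 2 * a) (10 - 2 * a)
  (2 * b) (20 - 2 * b) 10); try lia.
- by apply: JP.
- by apply: JP; lia.
- have -> : (a + b + (a - b) = 2 * a)%N by lia.
  have -> : (10 - (a + b) + (10 - (a - b)) = 20 - 2 * a)%N by lia.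
  by apply: thP; lia.
- have -> : (a + b + (10 - (a - b)) = 10 + 2 * b)%N by lia.
  have -> : (10 - (a + b) + (a - b) = 10 - 2 * b)%N by lia.
  by apply: thP; lia.
- by apply: thP; lia.
- by apply: thP; lia.
Qed.

Lemma JthC a : (a <= 10)%N -> Jth (10 - a) = Jth a.
Proof. by move=> a10; rewrite /Jth subKn //; ring. Qed.

(** The columns (F_a, G_a) for a = 0, 1, 2, 4 supply the six minors of the Pluecker relation; J_6 =
    J_4 enters through [JthC]. *)
Lemma weierstrass1 : Jth 2 ^+ 2 * Jth 3 * Jth 5 =
  Jth 1 * Jth 3 * Jth 4 ^+ 2 + q * Jth 1 ^+ 2 * Jth 2 * Jth 4.
Proof.
have H42 : Jth 4 * Jth 2 = _ := etrans (congr1 ( *%R^~ _) (esym (@JthC 4 isT))) (@theta_bilinear 4 2 isT isT isT).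
have H10 : Jth 1 * Jth 1 = _ := @theta_bilinear 1 0 isT isT isT.
have H41 : Jth 5 * Jth 3 = _ := @theta_bilinear 4 1 isT isT isT.
have H20 : Jth 2 * Jth 2 = _ := @theta_bilinear 2 0 isT isT isT.
have H40 : Jth 4 * Jth 4 = _ := @theta_bilinear 4 0 isT isT isT.
have H21 : Jth 3 * Jth 1 = _ := @theta_bilinear 2 1 isT isT isT.
transitivity ((Jth 5 * Jth 3) * (Jth 2 * Jth 2)); first by ring.
transitivity ((Jth 4 * Jth 4) * (Jth 3 * Jth 1) + q * (Jth 4 * Jth 2) * (Jth 1 * Jth 1)); last by ring.
by rewrite H42 H10 H41 H20 H40 H21 /=; ring.
Qed.

(** The same with the columns 0, 2, 3, 4, where J_7 = J_3 enters as well. *)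
Lemma weierstrass2 : Jth 1 * Jth 4 ^+ 2 * Jth 5 =
  Jth 2 * Jth 3 ^+ 2 * Jth 4 - q * Jth 1 * Jth 2 ^+ 2 * Jth 3.
Proof.
have H43 : Jth 3 * Jth 1 = _ := etrans (congr1 ( *%R^~ _) (esym (@JthC 3 isT))) (@theta_bilinear 4 3 isT isT isT).
have H20 : Jth 2 * Jth 2 = _ := @theta_bilinear 2 0 isT isT isT.
have H42 : Jth 4 * Jth 2 = _ := etrans (congr1 ( *%R^~ _) (esym (@JthC 4 isT))) (@theta_bilinear 4 2 isT isT isT).
have H30 : Jth 3 * Jth 3 = _ := @theta_bilinear 3 0 isT isT isT.
have H40 : Jth 4 * Jth 4 = _ := @theta_bilinear 4 0 isT isT isT.
have H32 : Jth 5 * Jth 1 = _ := @theta_bilinear 3 2 isT isT isT.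
transitivity ((Jth 4 * Jth 4) * (Jth 5 * Jth 1)); first by ring.
transitivity ((Jth 4 * Jth 2) * (Jth 3 * Jth 3) - q * (Jth 3 * Jth 1) * (Jth 2 * Jth 2)); last by ring.
by rewrite H42 H43 H20 H30 H40 H32 /=; ring.
Qed.

(** * Fifth roots of unity *)

Section FifthRoot.
Variable z : algC.
Hypothesis hz : 5.-primitive_root z.
Let w := z + z^-1.

Lemma root_neq0 : z != 0.
Proof.
apply/eqP => z0; have := prim_expr_order hz.
by rewrite z0 expr0n => /eqP; rewrite eq_sym oner_eq0.
Qed.

Lemma root_expr_neq1 k : ~~ (5 %| k)%N -> z ^+ k != 1.
Proof. by rewrite (prim_order_dvd hz). Qed.

Lemma w_sqr : w ^+ 2 = 1 - w.
Proof.
have z0 := root_neq0; have z5 := prim_expr_order hz.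
have z1 : z - 1 != 0 by rewrite subr_eq0 -[z]expr1 root_expr_neq1.
(* Multiplied by z^2 (z - 1), the relation becomes z^5 = 1. *)
apply: (mulfI z1); apply: (mulfI (expf_neq0 2 z0)); rewrite /w.
apply/eqP; rewrite -subr_eq0; apply/eqP.
have -> : z ^+ 2 * ((z - 1) * (z + z^-1) ^+ 2) - z ^+ 2 * ((z - 1) * (1 - (z + z^-1))) = z ^+ 5 - 1.
  by field.
by rewrite z5 subrr.
Qed.

(** Factor by factor this is 1 - X^5 as the product of 1 - y X over the fifth roots of unity y.
    Inverse roots are paired into quadratic factors, with traces w and -1 - w. *)
Lemma five_product :
  qpoch 1 1 1 * (qpoch z 1 1 * qpoch z^-1 1 1) * (qpoch (z ^+ 2) 1 1 * qpoch (z ^+ 2)^-1 1 1)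
  = qpoch 1 5 5.
Proof.
apply: feq_eq => N; have pE c : feq N (qpoch c 1 1) (pochn c 1 1 N) by apply: qpoch_feqW.
apply: (feq_trans (feqM (feqM (pE _) (feqM (pE _) (pE _))) (feqM (pE _) (pE _)))).
apply: feq_sym; apply: (feq_trans (@qpoch_feqW _ _ _ _ _)) => //.
rewrite /pochn -!big_split /=; apply: feq_prod => k _.
have -> : (5 + 5 * k = (1 + 1 * k) * 5)%N by lia.
rewrite exprM rmorph1; move: (q ^+ _) => X; rewrite !rmorphXn /=.
have zz : fconst z * fconst z^-1 = 1 by rewrite -rmorphM mulfV ?root_neq0 // rmorph1.
have -> : fconst (z ^+ 2)^-1 = fconst z^-1 ^+ 2 by rewrite -rmorphXn exprVn.
have ww : (fconst z + fconst z^-1) ^+ 2 = 1 - (fconst z + fconst z^-1).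
  by rewrite -rmorphD -rmorphXn w_sqr rmorphB rmorph1.
move: (fconst z) (fconst z^-1) zz ww => x y xy ww.
have E1 : (1 - x * X) * (1 - y * X) = 1 - (x + y) * X + X ^+ 2 by ring: xy.
have E2 : (1 - x ^+ 2 * X) * (1 - y ^+ 2 * X) = 1 + (1 + (x + y)) * X + X ^+ 2.
  transitivity (1 - ((x + y) ^+ 2 - 2 * (x * y)) * X + (x * y) ^+ 2 * X ^+ 2); first by ring.
  by rewrite ww xy; ring.
rewrite E1 E2; move: (x + y) ww => v vv.
have -> : (1 - 1 * X) * (1 - v * X + X ^+ 2) * (1 + (1 + v) * X + X ^+ 2) = 1 - 1 * X ^+ 5; last by [].
by ring: vv.
Qed.
End FifthRoot.

(** * Dissection of T(y) *)

Definition theta5 (Y : algC) (k : nat) : fps :=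
  qpoch Y k.+1 5 * qpoch Y^-1 (4 - k) 5 * qpoch 1 5 5.
Definition thetay (y : algC) : fps := qpoch y 1 1 * qpoch y^-1 1 1 * qpoch 1 1 1.

Lemma theta5P Y (k : 'I_5) : Y != 0 -> is_theta Y k.+1 (4 - k) (theta5 Y k).
Proof.
move=> Y0; have := @jtp Y k.+1 (4 - k) Y0.
by rewrite (_ : k.+1 + (4 - k) = 5)%N; [exact|have := ltn_ord k; lia].
Qed.

(** The factor 1 - y is the one that [qpoch y 0 1] has in excess of [qpoch y 1 1], so the left-hand
    side is a theta series. Its five classes start at the indices -1, 0, 1, 2, 3, with exponents 1,
    0, 0, 1, 3. *)
Lemma thetay_dissection y : y != 0 ->
  (1 - fconst y) * thetay y =
   - fconst y^-1 * q * fdil 5 (theta5 (y ^+ 5) 0) + fdil 5 (theta5 (y ^+ 5) 1)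
   - fconst y * fdil 5 (theta5 (y ^+ 5) 2) + fconst y ^+ 2 * q * fdil 5 (theta5 (y ^+ 5) 3)
   - fconst y ^+ 3 * q ^+ 3 * fdil 5 (theta5 (y ^+ 5) 4).
Proof.
move=> y0; have Y0 := expf_neq0 5 y0.
have := @jtp y 0 1 y0 isT; rewrite qpoch0 //= => H.
have := @theta_dissection y _ _ y0 H (fun k => theta5P k Y0).
rewrite !big_ord_recl big_ord0 addr0 => E.
have {}E : _ = fconst ((- y) ^ Negz 0) * q ^+ 1 * fdil 5 (theta5 (y ^+ 5) 0) +
  (fconst ((- y) ^+ 0) * q ^+ 0 * fdil 5 (theta5 (y ^+ 5) 1) +
  (fconst ((- y) ^+ 1) * q ^+ 0 * fdil 5 (theta5 (y ^+ 5) 2) +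
  (fconst ((- y) ^+ 2) * q ^+ 1 * fdil 5 (theta5 (y ^+ 5) 3) +
   fconst ((- y) ^+ 3) * q ^+ 3 * fdil 5 (theta5 (y ^+ 5) 4)))) := E.
transitivity ((1 - fconst y) * qpoch y 1 1 * qpoch y^-1 1 1 * qpoch 1 1 1).
  by rewrite /thetay; ring.
have yV : (- y) ^ Negz 0 = - y^-1 by rewrite -invrN.
rewrite E yV !rmorphXn /= !rmorphN.
by ring.
Qed.

Definition A5 : fps := qpoch 1 2 5 * qpoch 1 3 5 * qpoch 1 5 5.
Definition B5 : fps := qpoch 1 1 5 * qpoch 1 4 5 * qpoch 1 5 5.
Definition A5m : fps := qpoch (-1) 2 5 * qpoch (-1) 3 5 * qpoch 1 5 5.
Definition B5m : fps := qpoch (-1) 1 5 * qpoch (-1) 4 5 * qpoch 1 5 5.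
Definition C5m : fps := 2 * qpoch (-1) 5 5 ^+ 2 * qpoch 1 5 5.

Lemma fconst_unit c : c != 0 -> fconst c 0%N != 0.
Proof. by []. Qed.

(** For y^5 = 1 the last component contains 1 - q^0 and vanishes, and the other four coincide in
    pairs; then 1 - y divides out. *)
Lemma thetay_root y : y ^+ 5 = 1 -> y != 1 ->
  thetay y = fdil 5 A5 - (1 + fconst y + fconst y^-1) * q * fdil 5 B5.
Proof.
move=> y5 y1; have y0 : y != 0 by apply/eqP => y0; move/eqP: y5; rewrite y0 expr0n eq_sym oner_eq0.
have := thetay_dissection y0; rewrite y5 /theta5 invr1.
have -> : qpoch 1 5 5 * qpoch 1 (4 - 4) 5 * qpoch 1 5 5 = 0.
  by rewrite qpoch0 // rmorph1 subrr mul0r mulr0 mul0r.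
rewrite rmorph0 mulr0 subr0 -/A5 -/B5 => H.
apply: (@fps_mulIf (fconst (1 - y))); first by rewrite fconst_unit // subr_eq0 eq_sym.
rewrite rmorphB rmorph1 /= H.
have -> : qpoch 1 3 5 * qpoch 1 (4 - 2) 5 * qpoch 1 5 5 = A5 by rewrite /A5; ring.
have -> : qpoch 1 4 5 * qpoch 1 (4 - 3) 5 * qpoch 1 5 5 = B5 by rewrite /B5; ring.
have yy : fconst y * fconst y^-1 = 1 by rewrite -rmorphM mulfV // rmorph1.
move: (fconst y) (fconst y^-1) yy => c d cd.
move: (fdil _ A5) (fdil _ B5) q => a b x.
by ring: cd.
Qed.

Lemma thetay_minus_root z : 5.-primitive_root z -> let W := fconst z + fconst z^-1 in
  thetay (- z) = fdil 5 A5m + (W - 1) * q * fdil 5 B5m - W * q ^+ 3 * fdil 5 C5m.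
Proof.
move=> hz W; have z0 := root_neq0 hz; have z5 := prim_expr_order hz.
have mz0 : - z != 0 by rewrite oppr_eq0.
have mz5 : (- z) ^+ 5 = -1 by rewrite exprNn z5 mulr1 -signr_odd /= expr1.
have m1V : (-1)^-1 = -1 :> algC by rewrite invrN invr1.
have := thetay_dissection mz0; rewrite mz5 /theta5 m1V.
(* Here the factor at exponent 0 is 1 + 1, the source of the 2 in [C5m]. *)
have -> : qpoch (-1) 5 5 * qpoch (-1) (4 - 4) 5 * qpoch 1 5 5 = C5m.
  by rewrite qpoch0 // rmorphN1 /C5m; ring.
have -> : qpoch (-1) 3 5 * qpoch (-1) (4 - 2) 5 * qpoch 1 5 5 = A5m by rewrite /A5m; ring.
have -> : qpoch (-1) 4 5 * qpoch (-1) (4 - 3) 5 * qpoch 1 5 5 = B5m by rewrite /B5m; ring.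
rewrite -/A5m -/B5m.
have zz : fconst z * fconst z^-1 = 1 by rewrite -rmorphM mulfV // rmorph1.
have Ww : W ^+ 2 = 1 - W.
  by rewrite /W -rmorphD -rmorphXn (w_sqr hz) rmorphB rmorph1.
have z1 : 1 + z != 0.
  apply/eqP => /eqP; rewrite addrC addr_eq0 => /eqP zE.
  by have := root_expr_neq1 hz (isT : ~~ (5 %| 2)%N); rewrite zE sqrrN expr1n eqxx.
move=> H; apply: (@fps_mulIf (fconst (1 + z))); first by rewrite fconst_unit.
rewrite rmorphD rmorph1 /=; move: H; rewrite invrN !rmorphN /= !opprK => ->.
rewrite /W in Ww *; move: (fconst z) (fconst z^-1) zz Ww => x y xy ww.
move: (fdil _ A5m) (fdil _ B5m) (fdil _ C5m) q => a b c s.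
(* Each coefficient has to exhibit the factor 1 + z by which the goal was multiplied. *)
have c1 : x ^+ 2 + y = (1 + x) * (x + y - 1) by ring: xy.
have c3 : x ^+ 3 = - ((1 + x) * (x + y)).
  apply: (lincomb2 (a := x) (b := - (2 * x + y)) ww xy); ring.
transitivity ((1 + x) * a + (x ^+ 2 + y) * s * b + x ^+ 3 * s ^+ 3 * c); first by ring.
by rewrite c1 c3; ring.
Qed.

Lemma half2 : fconst 2^-1 * 2 = 1.
Proof.
have c2 : fconst 2 = 2 := rmorph_nat fconst 2.
by rewrite -c2 -rmorphM mulVf ?pnatr_eq0 // rmorph1.
Qed.

(** [lambert_product] evaluates 1 + 2 [lambert z], which is twice the bracket, and [five_product]
    resolves (q^5;q^5)_oo into the factors of T(z) and T(z^2). *)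
Lemma lhs_product z : 5.-primitive_root z ->
  2 * qpoch 1 2 2 * qpoch 1 5 5 ^+ 2 * lhs_2p14 z =
  thetay z * thetay (z ^+ 2) * thetay (z ^+ 2) * thetay (- z).
Proof.
move=> hz; have z0 := root_neq0 hz.
have lhsE : qpoch 1 1 1 * lhs_2p14 z * 2 = qpoch (-1) 1 1 * (1 + 2 * lambert z).
  have -> : lhs_2p14 z = fdiv (qpoch (-1) 1 1) (qp 1 1) * (fconst 2^-1 + lambert z) by [].
  rewrite -[RHS](_ : qpoch 1 1 1 * fdiv (qpoch (-1) 1 1) (qp 1 1) * (fconst 2^-1 * 2 + 2 * lambert z) = _).
    by ring.
  by rewrite half2 fdivP ?qpoch_unit.
have E2 : qpoch 1 2 2 = qpoch 1 1 1 * qpoch (-1) 1 1 by rewrite (@qpoch_sqr 1 1 1) // expr1n.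
have L := lambert_product z0; have five := five_product hz.
rewrite /thetay E2 invrN -five.
pose f := qpoch z 1 1 * qpoch z^-1 1 1 * qpoch (-1) 1 1.
apply: (@fps_mulIf f); first by rewrite /f !fps_mul0E !mulf_neq0 ?qpoch_unit.
rewrite /f.
move: L lhsE; move: (lambert z) (lhs_2p14 z) => l h.
move: (qpoch z 1 1) (qpoch z^-1 1 1) (qpoch (-1) 1 1) (qpoch 1 1 1) (qpoch (- z) 1 1) (qpoch (- z^-1) 1 1) => a b m e c d L H.
move: (qpoch _ 1 1) (qpoch _ 1 1) => u v.
transitivity ((e * h * 2) * m ^+ 2 * a * b * (e * (a * b) * (u * v)) ^+ 2); first by ring.
rewrite H.
transitivity (m * (a * b * (m ^+ 2 * (1 + 2 * l))) * (e * (a * b) * (u * v)) ^+ 2); first by ring.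
by rewrite L; ring.
Qed.

Lemma thetay_pair z : 5.-primitive_root z ->
  thetay z * thetay (z ^+ 2) = qpoch 1 1 1 * qpoch 1 5 5.
Proof. by move=> hz; rewrite -(five_product hz) /thetay; ring. Qed.

Section Dissections.
Variable z : algC.
Hypothesis hz : 5.-primitive_root z.
Let W := fconst z + fconst z^-1.

Lemma W_sqr : W ^+ 2 = 1 - W.
Proof. by rewrite /W -rmorphD -rmorphXn (w_sqr hz) rmorphB rmorph1. Qed.

Lemma thetay_z : thetay z = fdil 5 A5 - (1 + W) * q * fdil 5 B5.
Proof.
rewrite thetay_root ?(prim_expr_order hz) //; first by rewrite /W addrA.
by have := root_expr_neq1 hz (isT : ~~ (5 %| 1)%N).
Qed.

Lemma thetay_z2 : thetay (z ^+ 2) = fdil 5 A5 + W * q * fdil 5 B5.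
Proof.
have z5 := prim_expr_order hz.
rewrite thetay_root; last by have := root_expr_neq1 hz (isT : ~~ (5 %| 2)%N).
  have zz : fconst z * fconst z^-1 = 1 by rewrite -rmorphM mulfV ?(root_neq0 hz) // rmorph1.
  have -> : 1 + fconst (z ^+ 2) + fconst (z ^+ 2)^-1 = - W.
    rewrite -exprVn !rmorphXn /=.
    transitivity (W ^+ 2 + 1 - 2 * (fconst z * fconst z^-1)); first by rewrite /W; ring.
    by rewrite W_sqr zz; ring.
  by ring.
by rewrite -exprM mulnC exprM z5 expr1n.
Qed.

(** The dissection of [thetay_pair] under q -> q^2, which sends [A5] and [B5] to J_4 and J_2. *)
Lemma euler2_dissection : qpoch 1 2 2 * qpoch 1 10 10 =
  fdil 5 (Jth 4) ^+ 2 - q ^+ 2 * fdil 5 (Jth 4) * fdil 5 (Jth 2) - q ^+ 4 * fdil 5 (Jth 2) ^+ 2.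
Proof.
have H : qpoch 1 1 1 * qpoch 1 5 5 =
    fdil 5 A5 ^+ 2 - q * fdil 5 A5 * fdil 5 B5 - q ^+ 2 * fdil 5 B5 ^+ 2.
  rewrite -(thetay_pair hz) thetay_z thetay_z2.
  by have WW := W_sqr; move: W (fdil _ _) (fdil _ _) WW => v a b vv; ring: vv.
have EA : fdil 2 (fdil 5 A5) = fdil 5 (Jth 4) by rewrite /A5 /Jth !rmorphM /= !fdil_qpoch.
have EB : fdil 2 (fdil 5 B5) = fdil 5 (Jth 2) by rewrite /B5 /Jth !rmorphM /= !fdil_qpoch.
have G a b : fdil 2 (a ^+ 2 - q * a * b - q ^+ 2 * b ^+ 2) =
    fdil 2 a ^+ 2 - q ^+ 2 * fdil 2 a * fdil 2 b - q ^+ 4 * fdil 2 b ^+ 2.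
  by rewrite !rmorphB !rmorphM /= fdil_q; ring.
by rewrite -EA -EB -G -H rmorphM /= !fdil_qpoch.
Qed.
End Dissections.

Definition P10 (k : nat) : fps := qpoch 1 k 10 * qpoch 1 (10 - k) 10.

Lemma qpoch_split2 c a : qpoch c a 5 = qpoch c a 10 * qpoch c (a + 5) 10.
Proof. by rewrite (@qpoch_split 2 c a 5) // !big_ord_recl big_ord0 mulr1 /= muln0 addn0. Qed.

(** * All series of the theorem as products to modulus 10 *)

Section Q10.
Let p1 := P10 1. Let p2 := P10 2. Let p3 := P10 3. Let p4 := P10 4.
Let p5 := qpoch 1 5 10. Let t := qpoch 1 10 10.
Let i1 := finv p1. Let i2 := finv p2. Let i3 := finv p3.
Let i4 := finv p4. Let i5 := finv p5.

Lemma P10_unit k : (0 < k < 10)%N -> P10 k 0%N != 0.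
Proof.
by case/andP=> k0 k10; rewrite /P10 fps_mul0E mulf_neq0 ?qpoch_unit ?subn_gt0.
Qed.

Let e1 : p1 * i1 = 1. Proof. exact/finvP/P10_unit. Qed.
Let e2 : p2 * i2 = 1. Proof. exact/finvP/P10_unit. Qed.
Let e3 : p3 * i3 = 1. Proof. exact/finvP/P10_unit. Qed.
Let e4 : p4 * i4 = 1. Proof. exact/finvP/P10_unit. Qed.
Let e5 : p5 * i5 = 1. Proof. exact/finvP/qpoch_unit. Qed.
Let t0 : t 0%N != 0. Proof. exact: qpoch_unit. Qed.

(** Every term of [weierstrass1] has degree four in the J_a, so t^4 cancels. *)
Let w2 : p2 ^+ 2 * p3 * p5 ^+ 2 = p1 * p3 * p4 ^+ 2 + q * p1 ^+ 2 * p2 * p4.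
Proof.
have := weierstrass1; rewrite /Jth -/(P10 1) -/(P10 2) -/(P10 3) -/(P10 4) => H.
have t4 : (t ^+ 4) 0%N != 0 by rewrite !exprS expr0 mulr1 !fps_mul0E !mulf_neq0.
apply: (fps_mulIf t4); move: H; rewrite -/p1 -/p2 -/p3 -/p4 -/p5 -/t => H.
transitivity ((p2 * t) ^+ 2 * (p3 * t) * (p5 * p5 * t)); first by ring.
by rewrite H; ring.
Qed.

Let w3 : p1 * p4 ^+ 2 * p5 ^+ 2 = p2 * p3 ^+ 2 * p4 - q * p1 * p2 ^+ 2 * p3.
Proof.
have := weierstrass2; rewrite /Jth -/(P10 1) -/(P10 2) -/(P10 3) -/(P10 4) => H.
have t4 : (t ^+ 4) 0%N != 0 by rewrite !exprS expr0 mulr1 !fps_mul0E !mulf_neq0.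
apply: (fps_mulIf t4); move: H; rewrite -/p1 -/p2 -/p3 -/p4 -/p5 -/t => H.
transitivity ((p1 * t) * (p4 * t) ^+ 2 * (p5 * p5 * t)); first by ring.
by rewrite H; ring.
Qed.

Let q55 : qpoch 1 5 5 = p5 * t. Proof. exact: qpoch_split2. Qed.
Let q23 : qpoch 1 2 5 * qpoch 1 3 5 = p2 * p3.
Proof. by rewrite !qpoch_split2 /p2 /p3 /P10; ring. Qed.
Let q14 : qpoch 1 1 5 * qpoch 1 4 5 = p1 * p4.
Proof. by rewrite !qpoch_split2 /p1 /p4 /P10; ring. Qed.

Let A5E : A5 = p2 * p3 * p5 * t. Proof. by rewrite /A5 q23 q55; ring. Qed.
Let B5E : B5 = p1 * p4 * p5 * t. Proof. by rewrite /B5 q14 q55; ring. Qed.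

(** By [qpoch_sqr], the products at -1 are products to modulus 10 divided by the corresponding
    products at 1. *)
Let A5mE : A5m = p4 * i2 * i3 * p5 * t.
Proof.
have H : (qpoch 1 2 5 * qpoch 1 3 5) * (qpoch (-1) 2 5 * qpoch (-1) 3 5) = p4.
  by rewrite mulrACA !qpoch_sqr // expr1n.
by rewrite /A5m q55 -H q23; ring: e2 e3.
Qed.

Let B5mE : B5m = p2 * i1 * i4 * p5 * t.
Proof.
have H : (qpoch 1 1 5 * qpoch 1 4 5) * (qpoch (-1) 1 5 * qpoch (-1) 4 5) = p2.
  by rewrite mulrACA !qpoch_sqr // expr1n.
by rewrite /B5m q55 -H q14; ring: e1 e4.
Qed.

(** Euler's identity (-q;q)_oo (q;q^2)_oo = 1, taken at q^5. *)
Let C5mE : C5m = 2 * i5 * t.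
Proof.
have H : p5 * t * qpoch (-1) 5 5 = t by rewrite -q55 qpoch_sqr // expr1n.
rewrite /C5m q55 -{2}H.
have -> : qpoch (-1) 5 5 = i5; last by ring: e5.
apply: (fps_mulIf t0); transitivity (i5 * (p5 * t * qpoch (-1) 5 5)); last by rewrite H; ring.
by ring: e5.
Qed.

Let E1E : qpoch 1 1 1 = p1 * p2 * p3 * p4 * p5 * t.
Proof.
rewrite (@qpoch_split 5 1 1 1) // !big_ord_recl big_ord0 mulr1.
rewrite -[LHS]/(qpoch 1 1 5 * (qpoch 1 2 5 * (qpoch 1 3 5 * (qpoch 1 4 5 * qpoch 1 5 5)))).
transitivity ((qpoch 1 2 5 * qpoch 1 3 5) * (qpoch 1 1 5 * qpoch 1 4 5) * qpoch 1 5 5); first by ring.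
by rewrite q23 q14 q55; ring.
Qed.

Let E2E : qpoch 1 2 2 = p2 * p4 * t.
Proof.
rewrite (@qpoch_split 5 1 2 2) // !big_ord_recl big_ord0 mulr1.
rewrite -[LHS]/(qpoch 1 2 10 * (qpoch 1 4 10 * (qpoch 1 6 10 * (qpoch 1 8 10 * t)))).
by rewrite /p2 /p4 /P10; ring.
Qed.

Section Bs.
Variable z : algC.
Let W := fconst z + fconst z^-1.

Let wE : fconst (z + z^-1) = W. Proof. exact: rmorphD. Qed.

Let B0E : Bser z 0 = fconst 2^-1 * p5 ^+ 2 * t * p4 * i2 ^+ 2 * i3 ^+ 2 + W * (q * t * i3 * i4).
Proof.
have -> : Bser z 0 = fdiv (qpoch 1 5 5 * qpoch 1 5 5 * (qpoch 1 4 10 * qpoch 1 6 10))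
    (fconst 2 * (t * (qpoch 1 2 5 * qpoch 1 3 5 * (qpoch 1 2 5 * qpoch 1 3 5)))) +
  fconst (z + z^-1) * fdiv (q * t) (qpoch 1 3 10 * qpoch 1 4 10 * (qpoch 1 6 10 * qpoch 1 7 10)).
  by rewrite -[fconst (z + z^-1) * _]fscaleE.
rewrite wE; congr (_ + _ * _); apply: fdiv_eq.
- by rewrite !fps_mul0E !mulf_neq0 ?qpoch_unit // fconst_unit // pnatr_eq0.
- rewrite q55 q23 -[qpoch 1 4 10 * qpoch 1 6 10]/p4.
  have c2 : fconst 2 = 2 := rmorph_nat fconst 2.
  transitivity ((fconst 2^-1 * 2) * (p2 * i2) ^+ 2 * (p3 * i3) ^+ 2 * (p5 ^+ 2 * t ^+ 2 * p4)).
    by rewrite c2; ring.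
  by rewrite half2 e2 e3; ring.
- by rewrite !fps_mul0E !mulf_neq0 ?qpoch_unit.
have -> : qpoch 1 3 10 * qpoch 1 4 10 * (qpoch 1 6 10 * qpoch 1 7 10) = p3 * p4.
  by rewrite /p3 /p4 /P10; ring.
by ring: e3 e4.
Qed.

Let B1E : Bser z 1 = (W - 1) * (p4 * t * i2 ^+ 2 * i3).
Proof.
have -> : Bser z 1 = fconst (z + z^-1 - 1) *
   fdiv (qpoch 1 4 10 * qpoch 1 6 10 * t)
     (qpoch 1 2 10 * qpoch 1 8 10 * (qpoch 1 2 10 * qpoch 1 8 10) * (qpoch 1 3 10 * qpoch 1 7 10)).
  by rewrite -fscaleE.
rewrite rmorphB rmorph1 /= wE; congr (_ * _); apply: fdiv_eq.
  by rewrite !fps_mul0E !mulf_neq0 ?qpoch_unit.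
rewrite -[qpoch 1 2 10 * qpoch 1 8 10]/p2 -[qpoch 1 3 10 * qpoch 1 7 10]/p3.
by rewrite -[qpoch 1 4 10 * qpoch 1 6 10]/p4; ring: e2 e3.
Qed.

Let B2E : Bser z 2 = (1 - 2 * W) * (t * i1 * i4).
Proof.
have -> : Bser z 2 = fconst (1 - 2 * z - 2 * z^-1) *
   fdiv t (qpoch 1 1 10 * qpoch 1 9 10 * (qpoch 1 4 10 * qpoch 1 6 10)).
  by rewrite -fscaleE.
have -> : fconst (1 - 2 * z - 2 * z^-1) = 1 - 2 * W.
  rewrite (_ : 1 - 2 * z - 2 * z^-1 = 1 - 2%:R * (z + z^-1)); last by ring.
  by rewrite rmorphB rmorph1 rmorphM rmorph_nat rmorphD.
congr (_ * _); apply: fdiv_eq; first by rewrite !fps_mul0E !mulf_neq0 ?qpoch_unit.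
rewrite -[qpoch 1 1 10 * qpoch 1 9 10]/p1 -[qpoch 1 4 10 * qpoch 1 6 10]/p4.
by ring: e1 e4.
Qed.

Let B3E : Bser z 3 = - (t * i2 * i3).
Proof.
have -> : Bser z 3 = fconst (-1) * fdiv t (qpoch 1 2 5 * qpoch 1 3 5) by rewrite -fscaleE.
rewrite rmorphN1 mulN1r; congr (- _); apply: fdiv_eq.
  by rewrite !fps_mul0E !mulf_neq0 ?qpoch_unit.
by rewrite q23; ring: e2 e3.
Qed.

Let B4E : Bser z 4 = W * (p2 * t * i1 * i4 ^+ 2).
Proof.
have -> : Bser z 4 = fconst (z + z^-1) *
   fdiv (qpoch 1 2 10 * qpoch 1 8 10 * t)
     (qpoch 1 1 10 * qpoch 1 9 10 * (qpoch 1 4 10 * qpoch 1 6 10 * (qpoch 1 4 10 * qpoch 1 6 10))).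
  by rewrite -fscaleE.
rewrite wE; congr (_ * _); apply: fdiv_eq.
  by rewrite !fps_mul0E !mulf_neq0 ?qpoch_unit.
rewrite -[qpoch 1 1 10 * qpoch 1 9 10]/p1 -[qpoch 1 4 10 * qpoch 1 6 10]/p4.
by rewrite -[qpoch 1 2 10 * qpoch 1 8 10]/p2; ring: e1 e4.
Qed.

Lemma rhs_sum : rhs_2p14 z = \sum_(r < 5) q ^+ r * fdil 5 (Bser z r).
Proof.
apply: fpsP => n; rewrite fps_sumE /rhs_2p14; apply: eq_bigr => r _.
by rewrite -fqpowE.
Qed.

Hypothesis hz : 5.-primitive_root z.

Lemma level10_identity :
  fdil 5 (qpoch 1 2 2) * (thetay z * thetay (z ^+ 2) * thetay (z ^+ 2) * thetay (- z)) =
  2 * fdil 5 (qpoch 1 1 1) ^+ 2 * (qpoch 1 2 2 * qpoch 1 10 10 * rhs_2p14 z).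
Proof.
(* The hypotheses of [dissected_identity] are transported along q -> q^5, which fixes constants and
   sends the parameter [Q = q] to q^5; hence x can be q itself. *)
pose phi : fps -> fps := fdil 5.
have phiM a b : phi (a * b) = phi a * phi b by exact: rmorphM.
have phiX a n : phi (a ^+ n) = phi a ^+ n by exact: rmorphXn.
have phiD a b : phi (a + b) = phi a + phi b by exact: rmorphD.
have phiN a : phi (- a) = - phi a by exact: rmorphN.
have phi1 : phi 1 = 1 by exact: rmorph1.
have phiq : phi q = q ^+ 5 by exact: fdil_q.
have phiW : phi W = W by rewrite phiD /phi !fdil_const.
have phi2 : phi 2 = 2 by rewrite phiD phi1.
have phih : phi (fconst 2^-1) = fconst 2^-1 by exact: fdil_const.
have morph := (phiM, phiX, phiD, phiN, phi1, phiq, phiW, phi2, phih).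
have f1 := congr1 phi e1; have f2 := congr1 phi e2; have f3 := congr1 phi e3.
have f4 := congr1 phi e4; have f5 := congr1 phi e5.
have v2 := congr1 phi w2; have v3 := congr1 phi w3.
rewrite !morph in f1 f2 f3 f4 f5 v2 v3.
have eh : 2 * fconst 2^-1 = 1 by rewrite mulrC half2.
have H := dissected_identity (phi t) f1 f2 f3 f4 f5 eh (W_sqr hz) v2 v3 (erefl (q ^+ 5)).
have Hpair : thetay z * thetay (z ^+ 2) =
    phi A5 ^+ 2 - q * phi A5 * phi B5 - q ^+ 2 * phi B5 ^+ 2.
  rewrite (thetay_z hz) (thetay_z2 hz) -/phi -/W.
  by have WW := W_sqr hz; rewrite -/W in WW; move: W (phi _) (phi _) WW => v a b vv; ring: vv.
have rhsE : rhs_2p14 z = phi (Bser z 0) + q * phi (Bser z 1) +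
    q ^+ 2 * phi (Bser z 2) + q ^+ 3 * phi (Bser z 3) + q ^+ 4 * phi (Bser z 4).
  rewrite rhs_sum !big_ord_recl big_ord0 addr0 !addrA expr0 mul1r.
  by [].
rewrite Hpair (thetay_z2 hz) (thetay_minus_root hz) (euler2_dissection hz) rhsE.
rewrite -/phi -/W E1E E2E A5E B5E A5mE B5mE C5mE B0E B1E B2E B3E B4E.
rewrite -[Jth 4]/(p4 * t) -[Jth 2]/(p2 * t) !morph.
exact: H.
Qed.
End Bs.
End Q10.

Theorem theorem2p14 (zeta : algC) (hz : (5.-primitive_root zeta)%R) :
  lhs_2p14 zeta = rhs_2p14 zeta.
Proof.
(* The factor common to both sides: (q^10;q^10)_oo arises on the left as the dilate of (q^2;q^2)_oo,
   and the rest is the factor in [lhs_product]. *)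
pose f := 2 * qpoch 1 2 2 * qpoch 1 5 5 ^+ 2 * qpoch 1 10 10.
have f0 : f 0%N != 0.
  have two0 : (2 : fps) 0%N != 0.
    by rewrite -[2](rmorph_nat fconst 2) fconst_unit // pnatr_eq0.
  by rewrite /f expr2 !fps_mul0E !mulf_neq0 ?qpoch_unit.
have := level10_identity hz; rewrite -lhs_product // !fdil_qpoch //= => H.
by apply: (fps_mulIf f0); rewrite /f; etransitivity; [|etransitivity; [exact: H|]]; ring.
Qed.
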